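(* Let $k$ be a field of characteristic zero, let $R$ be an affine Poisson $k$-algebra, and let $H=(k^\times)^r$ be an algebraic torus acting rationally on $R$ by Poisson automorphisms. Assume that $R$ has only finitely many prime Poisson $H$-ideals, and let $J$ be one of them. For $P\in \operatorname{P.spec}_J R$, the following conditions are equivalent: (a) $P$ is locally closed in $\operatorname{P.spec} R$. (b) $P$ is Poisson primitive. (c) $Z_P(\operatorname{Fract} R/P)$ is algebraic over $k$. (d) $P$ is maximal in $\operatorname{P.spec}_J R$.
   Context: Algebras are associative, commutative and unital. Affine means finitely generated as a $k$-algebra. A Poisson $k$-algebra is a commutative $k$-algebra $R$ with a $k$-bilinear map $\{-,-\}:R\times R\to R$ (Poisson bracket) making $R$ a Lie algebra over $k$ and such that $\{a,-\}$ is a derivation for each $a\in R$. A Poisson automorphism is a $k$-algebra automorphism preserving the bracket. A Poisson ideal is an ideal $I$ with $\{R,I\}\subseteq I$. The Poisson core $\operatorname{P.core}(J)$ of an ideal $J$ is the largest Poisson ideal contained in $J$. The Poisson primitive ideals are the Poisson cores of the maximal ideals of $R$. A Poisson-prime ideal is a proper Poisson ideal $Q$ such that for Poisson ideals $I,J$ with $IJ\subseteq Q$, either $I\subseteq Q$ or $J\subseteq Q$; when $R$ is noetherian these are exactly the ideals that are both Poisson ideals and prime ideals. $\operatorname{P.spec} R$ is the set of Poisson-prime ideals of $R$ with the Zariski topology (closed sets $\{P\in\operatorname{P.spec}R\mid P\supseteq I\}$ for ideals $I$ of $R$). A point of a topological space is locally closed if it is (relatively) closed in some neighborhood of itself. The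 Poisson center is $Z_P(R)=\{r\in R\mid \{a,r\}=0\text{ for all }a\in R\}$. For a prime Poisson ideal $P$, the quotient field $\operatorname{Fract} R/P$ of the domain $R/P$ carries the induced Poisson structure. An algebraic torus over $k$ is a group $H=(k^\times)^r$, $r\ge 0$; a rational character of $H$ is a group homomorphism $H\to k^\times$ that is also a morphism of algebraic varieties. When $H$ acts on $R$ by $k$-algebra automorphisms, an $H$-eigenvector is a nonzero $v\in R$ with $h(v)\in kv$ for all $h\in H$; its $H$-eigenvalue is the character $f$ with $h(v)=f(h)v$ for all $h$. The action is rational if $R$ is the direct sum of its $H$-eigenspaces and all the corresponding $H$-eigenvalues are rational characters. An $H$-ideal is an ideal $I$ with $h(I)=I$ for all $h\in H$; for an ideal $I$, $(I:H)=\bigcap_{h\in H}h(I)$. A prime Poisson $H$-ideal is a prime ideal that is both a Poisson ideal and an $H$-ideal. For such $J$, the $H$-stratum is $\operatorname{P.spec}_J R=\{P\in\operatorname{P.spec}R\mid (P:H)=J\}$. Maximality in (d) is with respect to inclusion. *)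

(* Defs.v *)
From HB Require Import structures.
From mathcomp Require Import all_boot all_order all_algebra.
From mathcomp Require Import generic_quotient ring_quotient fraction ring.
From mathcomp Require Import all_classical topology_structure.

Set Implicit Arguments.
Unset Strict Implicit.
Unset Printing Implicit Defensive.

Import GRing.Theory.
Local Open Scope classical_set_scope.
Local Open Scope ring_scope.
Local Open Scope quotient_scope.

HB.mixin Record isPoisson (k : fieldType) R of GRing.ComAlgebra k R := {
  pbracket : R -> R -> R;
  pbracket_linearl : forall b, linear (pbracket^~ b);
  pbracket_linearr : forall a, linear (pbracket a);
  pbracketxx : forall a, pbracket a a = 0;
  pbracket_jacobi : forall a b c,
    pbracket a (pbracket b c) + pbracket b (pbracket c a)
      + pbracket c (pbracket a b) = 0;
  pbracket_leibniz : forall a b c,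
    pbracket a (b * c) = pbracket a b * c + b * pbracket a c
}.

#[short(type="poissonAlgType")]
HB.structure Definition PoissonAlgebra (k : fieldType) :=
  {R of GRing.ComAlgebra k R & isPoisson k R}.

Section PoissonTheory.
Variables (k : fieldType) (R : poissonAlgType k).
Implicit Types a b c : R.

Lemma pbracketDl a b c : pbracket (a + b) c = pbracket a c + pbracket b c.
Proof. by have := pbracket_linearl c 1 a b; rewrite !scale1r. Qed.

Lemma pbracketDr a b c : pbracket a (b + c) = pbracket a b + pbracket a c.
Proof. by have := pbracket_linearr a 1 b c; rewrite !scale1r. Qed.

Lemma pbracketC a b : pbracket a b = - pbracket b a.
Proof.
have := pbracketxx (a + b).
rewrite pbracketDl !pbracketDr !pbracketxx add0r addr0 => /eqP.
by rewrite addr_eq0 => /eqP.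
Qed.

Lemma pbracketBr a b c : pbracket a (b - c) = pbracket a b - pbracket a c.
Proof. by apply/esym/eqP; rewrite subr_eq -pbracketDr subrK eqxx. Qed.

Lemma pbracketZr (l : k) a b : pbracket a (l *: b) = l *: pbracket a b.
Proof.
have a0 : pbracket a 0 = 0 :> R by rewrite -[X in pbracket a X](subrr 0) pbracketBr subrr.
have := pbracket_linearr a l b 0.
by rewrite !addr0 [pbracket a 0 in RHS]a0 addr0.
Qed.

End PoissonTheory.

Definition affine (k : fieldType) (R : comAlgType k) :=
  exists s : seq R, forall S : {pred R},
    subalg_closed S -> {subset s <= S} -> forall x, x \in S.

Section Ideals.
Variable R : comNzRingType.

(* Unlike the idealr of ring_quotient, ideals need not be proper here. *)
Record is_ideal (I : set R) : Prop := IsIdeal {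
  ideal0 : I 0;
  idealD : forall x y, I x -> I y -> I (x + y);
  idealM : forall a x, I x -> I (a * x)
}.

Record prime_ideal (P : set R) : Prop := PrimeIdeal {
  prime_idealP : is_ideal P;
  prime_ideal1 : ~ P 1;
  prime_idealM : forall x y, P (x * y) -> P x \/ P y
}.

Record maximal_ideal (M : set R) : Prop := MaximalIdeal {
  maximal_idealP : is_ideal M;
  maximal_ideal1 : ~ M 1;
  maximal_idealE : forall I, is_ideal I -> ~ I 1 -> M `<=` I -> I = M
}.

End Ideals.

Section PoissonIdeals.
Variables (k : fieldType) (R : poissonAlgType k).
Implicit Types I J P M : set R.

Definition poisson_ideal I :=
  is_ideal I /\ forall a x, I x -> I (pbracket a x).

(* IJ is contained in Q iff Q contains all products of an element of I with
   an element of J. *)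
Record poisson_prime (Q : set R) : Prop := PoissonPrime {
  poisson_primeP : poisson_ideal Q;
  poisson_prime1 : ~ Q 1;
  poisson_primeM : forall I J, poisson_ideal I -> poisson_ideal J ->
    (forall x y, I x -> J y -> Q (x * y)) -> I `<=` Q \/ J `<=` Q
}.

(* C = P.core(J) *)
Definition is_poisson_core J C :=
  [/\ poisson_ideal C, C `<=` J &
      forall I, poisson_ideal I -> I `<=` J -> I `<=` C].

Definition poisson_primitive P :=
  exists2 M, maximal_ideal M & is_poisson_core M P.

End PoissonIdeals.

Section PoissonSpectrum.
Variables (k : fieldType) (R : poissonAlgType k).

Record pspec := Pspec {
  pspec_ideal :> set R;
  pspecP : poisson_prime pspec_ideal
}.

Definition zariski_closed (C : set pspec) :=
  exists2 I : set R, is_ideal I & C = [set P : pspec | I `<=` P].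

Definition zariski_open (U : set pspec) := zariski_closed (~` U).

(* The Poisson ideal generated by I. *)
Let phull (I : set R) : set R :=
  [set x | forall K, poisson_ideal K -> I `<=` K -> K x].

Let sub_phull I : I `<=` phull I.
Proof. by move=> x Ix K _; apply. Qed.

Let phull_ideal I : poisson_ideal (phull I).
Proof.
split; first split.
- by move=> K [[]].
- move=> x y Ix Iy K pK IK; case: (pK) => -[_ KD _] _.
  by apply: KD; [apply: Ix | apply: Iy].
- move=> a x Ix K pK IK; case: (pK) => -[_ _ KM] _.
  by apply: KM; apply: Ix.
- move=> a x Ix K pK IK; case: (pK) => _; apply.
  exact: Ix.
Qed.

Let phull_sub I (P : pspec) : (phull I `<=` P) <-> (I `<=` P).
Proof.
split=> IP; first exact: subset_trans (@sub_phull I) IP.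
by move=> x; apply => //; exact: poisson_primeP (pspecP P).
Qed.

Let zariski_openT : zariski_open setT.
Proof.
exists setT; first by split.
rewrite setCT; apply/seteqP; split=> // P /= TP.
exact: poisson_prime1 (pspecP P) (TP 1 Logic.I).
Qed.

Let zariski_openI : setI_closed zariski_open.
Proof.
move=> U V [I _ UI] [J _ VJ]; rewrite /zariski_open setCI UI VJ.
have [[I0 ID IM] Ib] := phull_ideal I.
have [[J0 JD JM] Jb] := phull_ideal J.
exists (phull I `&` phull J).
  split=> [|x y [? ?] [? ?]|a x [? ?]]; split;
    by [|apply: ID|apply: JD|apply: IM|apply: JM].
apply/seteqP; split=> P /=.
  by case=> /phull_sub sP x [] *; apply: sP.
move=> sP; have pP := pspecP P.
case: (poisson_primeM pP (phull_ideal I) (phull_ideal J)).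
- move=> x y Ix Jy; apply: sP; split; last exact: JM.
  by rewrite mulrC; apply: IM.
- by move/phull_sub; left.
- by move/phull_sub; right.
Qed.

Let zariski_open_bigU (T : Type) (U : T -> set pspec) :
  (forall i, zariski_open (U i)) -> zariski_open (\bigcup_i U i).
Proof.
move=> oU; pose I i := projT1 (cid2 (oU i)).
have IE i : ~` U i = [set P : pspec | I i `<=` P].
  by rewrite /I; case: cid2.
have [hI _] := phull_ideal (\bigcup_i I i).
exists (phull (\bigcup_i I i)) => //.
rewrite setC_bigcup; apply/seteqP; split=> P /=.
  move=> UP; apply/phull_sub => x [i _ Ix].
  have : (~` U i) P by exact: UP.
  by rewrite IE; apply.
move/phull_sub=> sP i _; rewrite IE => x Ix.
by apply: sP; exists i.
Qed.

HB.instance Definition _ := gen_eqMixin pspec.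
HB.instance Definition _ := gen_choiceMixin pspec.
HB.instance Definition _ :=
  isOpenTopological.Build pspec zariski_openT zariski_openI zariski_open_bigU.

Lemma pspec_closedE (C : set pspec) : closed C <-> zariski_closed C.
Proof. by rewrite -openC /open /= /zariski_open setCK. Qed.

End PoissonSpectrum.

Arguments pspec {k} R.

Definition locally_closed_point (T : topologicalType) (x : T) :=
  exists2 U, nbhs x U & exists2 C, closed C & C `&` U = [set x].

Section PrimeQuotient.
Variables (R : comNzRingType) (P : set R) (primeP : prime_ideal P).

(* The proof of primality is a phantom argument that carries the prime_idealr
   instance. *)
Definition prime_pred of prime_ideal P : {pred R} := fun x => x \in P.
Local Notation PP := (prime_pred primeP).

Let inP x : x \in PP -> P x.
Proof. by rewrite unfold_in inE. Qed.

Let Pin x : P x -> x \in PP.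
Proof. by rewrite unfold_in inE. Qed.

Let prime_zmod : zmod_closed PP.
Proof.
have [[P0 PD PM] _ _] := primeP; split=> [|x y /inP Px /inP Py].
  exact: Pin.
by apply/Pin/PD => //; rewrite -mulN1r; apply: PM.
Qed.

Let prime_proper : 1 \notin PP /\ forall a, {in PP, forall u, a * u \in PP}.
Proof.
have [[P0 PD PM] P1 _] := primeP.
split=> [|a x /inP Px]; last exact/Pin/PM.
by apply/negP => /inP.
Qed.

Let prime_prime : prime_idealr_closed PP.
Proof.
have [_ _ Pp] := primeP => x y /inP /Pp [] /Pin -> //.
by rewrite orbT.
Qed.

HB.instance Definition _ := GRing.isZmodClosed.Build R PP prime_zmod.
HB.instance Definition _ := isProperIdeal.Build _ PP prime_proper.
HB.instance Definition _ := isPrimeIdealrClosed.Build R PP prime_prime.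

Definition prime_quot := {ideal_quot PP}.

HB.instance Definition _ := GRing.ComNzRing.on prime_quot.

Let quot_unit : {pred prime_quot} := fun x => `[< exists y, y * x = 1 >].
Let quot_inv (x : prime_quot) : prime_quot :=
  if pselect (exists y, y * x = 1) is left h then projT1 (cid h) else x.

Let quot_mulVx : {in quot_unit, left_inverse 1 quot_inv *%R}.
Proof.
move=> x /asboolP hx; rewrite /quot_inv; case: pselect => // h.
by case: cid.
Qed.

Let quot_unitP (x y : prime_quot) : y * x = 1 -> quot_unit x.
Proof. by move=> yx; apply/asboolP; exists y. Qed.

Let quot_invx0 : {in [predC quot_unit], quot_inv =1 id}.
Proof.
by move=> x /asboolP hx; rewrite /quot_inv; case: pselect.
Qed.

HB.instance Definition _ := GRing.ComNzRing_hasMulInverse.Build prime_quot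
  quot_mulVx quot_unitP quot_invx0.

Let quot_idomain : GRing.integral_domain_axiom prime_quot.
Proof. exact: (@Quotient.rquot_IdomainAxiom _ PP). Qed.

HB.instance Definition _ :=
  GRing.ComUnitRing_isIntegral.Build prime_quot quot_idomain.

Definition residue (x : R) : prime_quot := \pi_{ideal_quot PP} x.

Lemma residue_eq x y : residue x = residue y <-> P (x - y).
Proof.
rewrite /residue; split=> [/eqP|/Pin].
  by rewrite -Quotient.idealrBE => /inP.
by rewrite Quotient.idealrBE => /eqP.
Qed.

Lemma residueD : {morph residue : x y / x + y}.
Proof. by move=> x y; rewrite /residue !piE. Qed.

Lemma residueM : {morph residue : x y / x * y}.
Proof. by move=> x y; rewrite /residue !piE. Qed.

Lemma residue_repr (x : prime_quot) : residue (repr x) = x.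
Proof. exact: reprK. Qed.

End PrimeQuotient.

Section PoissonQuotient.
Variables (k : fieldType) (R : poissonAlgType k).
Variables (P : set R) (primeP : prime_ideal P).

(* Independent of the representatives when P is a Poisson ideal, by
   quot_pbracketE. *)
Definition quot_pbracket (x y : prime_quot primeP) : prime_quot primeP :=
  residue primeP (pbracket (repr x) (repr y)).

Lemma quot_pbracketE : poisson_ideal P -> forall a b,
  quot_pbracket (residue primeP a) (residue primeP b)
    = residue primeP (pbracket a b).
Proof.
move=> [[P0 PD PM] Pb] a b; rewrite /quot_pbracket.
set a' := repr _; set b' := repr _.
have Pa : P (a' - a) by apply/(residue_eq primeP); rewrite residue_repr.
have Pc : P (b' - b) by apply/(residue_eq primeP); rewrite residue_repr.
apply/residue_eq.
have -> : pbracket a' b' - pbracket a b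
    = pbracket a' (b' - b) + (-1) * pbracket b (a' - a).
  by rewrite !pbracketBr (pbracketC b a') (pbracketC b a) mulN1r; ring.
by apply: PD; [apply: Pb | apply: PM; apply: Pb].
Qed.

End PoissonQuotient.

(* K is the fraction field of D; it is kept abstract because the field tactic
   is impractical on {fraction D}. *)
Section FractionBracketTheory.
Variables (D : idomainType) (K : fieldType) (i : {rmorphism D -> K}).
Variables (br : D -> D -> D) (fb : K -> K -> K).
Local Notation "x %:F" := (i x).

Hypothesis iI : injective i.
Hypothesis fbE : forall x y, exists a b c d,
  [/\ b != 0, d != 0, x = a%:F / b%:F, y = c%:F / d%:F &
   fb x y = ((br a c)%:F - y * (br a d)%:F - x * (br b c)%:F
             + x * y * (br b d)%:F) / (b%:F * d%:F)].
Hypothesis br_alt : forall a, br a a = 0.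
Hypothesis brDl : forall a b c, br (a + b) c = br a c + br b c.
Hypothesis brC : forall a b, br a b = - br b a.
Hypothesis brM : forall a b c, br a (b * c) = br a b * c + b * br a c.

Let iE0 a : (a%:F == 0) = (a == 0).
Proof. by rewrite -(inj_eq iI) rmorph0. Qed.

Let frac_numden x : exists a b, b != 0 /\ x = a%:F / b%:F.
Proof. by have [a [b [c [d []]]]] := fbE x x; exists a, b. Qed.

Let slope (f : D -> K) a b a' b' (x : K) :
  (forall u v, f (u * v) = f u * v%:F + u%:F * f v) ->
  b != 0 -> b' != 0 -> x = a%:F / b%:F -> x = a'%:F / b'%:F ->
  (f a - x * f b) / b%:F = (f a' - x * f b') / b'%:F.
Proof.
move=> fM b0 b'0 xa xa'.
have B0 : b%:F != 0 by rewrite iE0.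
have B'0 : b'%:F != 0 by rewrite iE0.
have aE : a%:F = x * b%:F by rewrite xa divfK.
have a'E : a'%:F = x * b'%:F by rewrite xa' divfK.
have e : a * b' = b * a'.
  by apply: iI; rewrite !rmorphM aE a'E; ring.
apply/eqP; rewrite eqr_div //; apply/eqP.
have := congr1 f e; rewrite !fM aE a'E => ef.
have {ef}-> : f a = (f b * (x * b'%:F) + b%:F * f a' - x * b%:F * f b') / b'%:F.
  by rewrite -ef addrK mulfK.
by field.
Qed.

Let brDr a b c : br a (b + c) = br a b + br a c.
Proof. by rewrite brC brDl opprD -!brC. Qed.

Let brMl a b c : br (a * b) c = br a c * b + a * br b c.
Proof. by rewrite brC brM (brC a) (brC b); ring. Qed.

Lemma fb_fracE a b c d : b != 0 -> d != 0 ->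
  fb (a%:F / b%:F) (c%:F / d%:F)
    = ((br a c)%:F - c%:F / d%:F * (br a d)%:F - a%:F / b%:F * (br b c)%:F
         + a%:F / b%:F * (c%:F / d%:F) * (br b d)%:F) / (b%:F * d%:F).
Proof.
move=> b0 d0; set x := a%:F / b%:F; set y := c%:F / d%:F.
have [a1 [b1 [c1 [d1 [b10 d10 xE yE ->]]]]] := fbE x y.
have [B0 D0] : b%:F != 0 /\ d%:F != 0 by rewrite !iE0.
have [B10 D10] : b1%:F != 0 /\ d1%:F != 0 by rewrite !iE0.
pose f u := ((br u c1)%:F - y * (br u d1)%:F) / d1%:F.
have fM u v : f (u * v) = f u * v%:F + u%:F * f v.
  by rewrite /f !brMl !(rmorphD, rmorphM); field.
pose g u := ((br a u)%:F - x * (br b u)%:F) / b%:F.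
have gM u v : g (u * v) = g u * v%:F + u%:F * g v.
  by rewrite /g !brM !(rmorphD, rmorphM); field.
have fE := slope fM b10 b0 xE erefl.
have gE := slope gM d10 d0 yE erefl.
have -> : ((br a1 c1)%:F - y * (br a1 d1)%:F - x * (br b1 c1)%:F +
   x * y * (br b1 d1)%:F) / (b1%:F * d1%:F) = (f a1 - x * f b1) / b1%:F.
  by rewrite /f; field; apply/andP.
rewrite fE.
have -> : (f a - x * f b) / b%:F = (g c1 - y * g d1) / d1%:F.
  by rewrite /f /g; field; apply/andP.
by rewrite gE /g; field; apply/andP.
Qed.

Lemma fb_tofrac a b : fb a%:F b%:F = (br a b)%:F.
Proof.
have br1 u : br u 1 = 0.
  by have := brM u 1 1; rewrite !mulr1 mul1r -[X in X = _]addr0 => /addrI.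
have := @fb_fracE a 1 b 1 (oner_neq0 _) (oner_neq0 _).
rewrite (brC 1) !br1 rmorph1 !divr1 => ->.
by rewrite oppr0 rmorph0 !(mulr0, subr0, addr0) mulr1 divr1.
Qed.

Lemma fbC x y : fb x y = - fb y x.
Proof.
have [[a [b [b0 ->]]] [c [d [d0 ->]]]] := (frac_numden x, frac_numden y).
have [B0 D0] : b%:F != 0 /\ d%:F != 0 by rewrite !iE0.
rewrite !fb_fracE // (brC a c) (brC a d) (brC b c) (brC b d) !rmorphN.
by field; apply/andP.
Qed.

Lemma fbxx x : fb x x = 0.
Proof.
have [a [b [b0 ->]]] := frac_numden x.
have B0 : b%:F != 0 by rewrite !iE0.
by rewrite fb_fracE // !br_alt (brC b a) rmorphN rmorph0; field.
Qed.

Lemma fbDr x y z :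
  fb x (y + z) = fb x y + fb x z.
Proof.
have [a [b [b0 ->]]] := frac_numden x.
have [[c [d [d0 ->]]] [e [f [f0 ->]]]] := (frac_numden y, frac_numden z).
have [[B0 D0] F0] : (b%:F != 0 /\ d%:F != 0) /\ f%:F != 0.
  by rewrite !iE0.
have -> : c%:F / d%:F + e%:F / f%:F = (c * f + e * d)%:F / (d * f)%:F.
  by rewrite rmorphD !rmorphM; field; apply/andP.
rewrite !fb_fracE ?mulf_neq0 // !(brDr, brM) !(rmorphD, rmorphM).
by field; apply/and3P; split.
Qed.

Lemma fb_leibniz x y z :
  fb x (y * z) = fb x y * z + y * fb x z.
Proof.
have [a [b [b0 ->]]] := frac_numden x.
have [[c [d [d0 ->]]] [e [f [f0 ->]]]] := (frac_numden y, frac_numden z).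
have [[B0 D0] F0] : (b%:F != 0 /\ d%:F != 0) /\ f%:F != 0.
  by rewrite !iE0.
have -> : c%:F / d%:F * (e%:F / f%:F) = (c * e)%:F / (d * f)%:F.
  by rewrite !rmorphM; field; apply/andP.
rewrite !fb_fracE ?mulf_neq0 // !brM !(rmorphD, rmorphM).
by field; apply/and3P; split.
Qed.

Hypothesis br_jacobi : forall a b c,
  br a (br b c) + br b (br c a) + br c (br a b) = 0.

Let derivation0 (f : K -> K) :
  (forall x y, f (x * y) = f x * y + x * f y) ->
  (forall a, f a%:F = 0) -> forall x, f x = 0.
Proof.
move=> fM f0 x; have [a [b [b0 xE]]] := frac_numden x.
have B0 : b%:F != 0 by rewrite iE0.
have := fM x b%:F; rewrite {1}xE divfK // !f0 mulr0 addr0 => /esym/eqP.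
by rewrite mulf_eq0 (negPf B0) orbF => /eqP.
Qed.

Lemma fb_jacobi x y z :
  fb x (fb y z) + fb y (fb z x)
    + fb z (fb x y) = 0.
Proof.
pose J u v w := fb u (fb v w)
  + fb v (fb w u) + fb w (fb u v).
have JC u v w : J u v w = J v w u by rewrite /J; ring.
have Ml u v w : fb (u * v) w
    = fb u w * v + u * fb v w.
  by rewrite fbC fb_leibniz (fbC u)
    (fbC v); ring.
have JM v w u u' : J (u * u') v w = J u v w * u' + u * J u' v w.
  rewrite /J !(fb_leibniz, Ml, fbDr).
  by rewrite (fbC u v) (fbC u' v); ring.
have J1 a v w : J a%:F v w = 0.
  rewrite JC; move: v w => v w.
  have J2 b : J v b%:F a%:F = 0.
    apply: (derivation0 (f := fun v => J v b%:F a%:F)) => [u u'|c].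
      exact: JM.
    by rewrite /J !fb_tofrac -!rmorphD br_jacobi rmorph0.
  rewrite JC; apply: (derivation0 (f := fun w => J w a%:F v)) => [u u'|b].
    exact: JM.
  by rewrite JC JC J2.
exact: (derivation0 (JM y z) (fun a => J1 a y z)).
Qed.

End FractionBracketTheory.

Section FractionBracket.
Variables (D : idomainType) (br : D -> D -> D).
Local Notation "x %:F" := (@FracField.tofrac D x).

(* The Leibniz rule forces
   {a/b, c/d} = ({a,c} - (c/d){a,d} - (a/b){b,c} + (a/b)(c/d){b,d}) / (bd);
   the value does not depend on the fractions a/b and c/d, see
   frac_pbracketE. *)
Definition frac_pbracket (x y : {fraction D}) : {fraction D} :=
  let a := \n_(repr x) in let b := \d_(repr x) in
  let c := \n_(repr y) in let d := \d_(repr y) in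
  ((br a c)%:F - y * (br a d)%:F - x * (br b c)%:F + x * y * (br b d)%:F)
    / (b%:F * d%:F).

Lemma frac_repr (x : {fraction D}) :
  \d_(repr x) != 0 /\ x = (\n_(repr x))%:F / (\d_(repr x))%:F.
Proof.
have d0 := denom_ratioP (repr x); split=> //.
apply: (@mulIf _ (\d_(repr x))%:F); first by rewrite tofrac_eq0.
rewrite divfK ?tofrac_eq0 //.
rewrite -{1}[x]reprK; move: (repr x) d0 => r d0.
rewrite -{1}[r]Ratio_numden /FracField.tofrac; unlock.
rewrite -[_ * _]/(FracField.mul _ _) -!(FracField.pi_mul).
apply/eqP; rewrite piE /FracField.mulf /FracField.equivf /=.
by rewrite !numden_Ratio ?mulf_neq0 ?oner_eq0 //; apply/eqP; ring.
Qed.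

Let frac_pbracket_def x y : exists a b c d,
  [/\ b != 0, d != 0, x = a%:F / b%:F, y = c%:F / d%:F &
   frac_pbracket x y = ((br a c)%:F - y * (br a d)%:F - x * (br b c)%:F
             + x * y * (br b d)%:F) / (b%:F * d%:F)].
Proof.
have [[? ?] [? ?]] := (frac_repr x, frac_repr y).
by do 4![eexists]; split; last by [].
Qed.

Let tofrac_inj : injective (@FracField.tofrac D).
Proof. by move=> a b /eqP; rewrite tofrac_eq => /eqP. Qed.

Hypothesis br_alt : forall a, br a a = 0.
Hypothesis brDl : forall a b c, br (a + b) c = br a c + br b c.
Hypothesis brC : forall a b, br a b = - br b a.
Hypothesis brM : forall a b c, br a (b * c) = br a b * c + b * br a c.


Lemma frac_pbracketE a b c d : b != 0 -> d != 0 ->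
  frac_pbracket (a%:F / b%:F) (c%:F / d%:F)
    = ((br a c)%:F - c%:F / d%:F * (br a d)%:F - a%:F / b%:F * (br b c)%:F
         + a%:F / b%:F * (c%:F / d%:F) * (br b d)%:F) / (b%:F * d%:F).
Proof. exact: (fb_fracE tofrac_inj frac_pbracket_def). Qed.

Lemma frac_pbracket_tofrac a b : frac_pbracket a%:F b%:F = (br a b)%:F.
Proof. exact: (fb_tofrac tofrac_inj frac_pbracket_def). Qed.

Lemma frac_pbracketxx x : frac_pbracket x x = 0.
Proof. exact: (fbxx tofrac_inj frac_pbracket_def). Qed.

Lemma frac_pbracketC x y : frac_pbracket x y = - frac_pbracket y x.
Proof. exact: (fbC tofrac_inj frac_pbracket_def). Qed.

Lemma frac_pbracketDr x y z :
  frac_pbracket x (y + z) = frac_pbracket x y + frac_pbracket x z.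
Proof. exact: (fbDr tofrac_inj frac_pbracket_def). Qed.

Lemma frac_pbracket_leibniz x y z :
  frac_pbracket x (y * z) = frac_pbracket x y * z + y * frac_pbracket x z.
Proof. exact: (fb_leibniz tofrac_inj frac_pbracket_def). Qed.

Lemma frac_pbracket_jacobi x y z :
  (forall a b c, br a (br b c) + br b (br c a) + br c (br a b) = 0) ->
  frac_pbracket x (frac_pbracket y z) + frac_pbracket y (frac_pbracket z x)
    + frac_pbracket z (frac_pbracket x y) = 0.
Proof. by move=> ?; apply: (fb_jacobi tofrac_inj frac_pbracket_def). Qed.

End FractionBracket.

Definition poisson_center (A : zmodType) (br : A -> A -> A) : set A :=
  [set r | forall a, br a r = 0].

Section FractQuotient.
Variables (k : fieldType) (R : poissonAlgType k).
Variables (P : set R) (primeP : prime_ideal P).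

Definition fract : fieldType := {fraction prime_quot primeP}.

Definition to_fract (a : R) : fract :=
  FracField.tofrac (residue primeP a).

Definition scalar_to_fract (l : k) : fract := to_fract l%:A.

Definition fract_pbracket : fract -> fract -> fract :=
  frac_pbracket (quot_pbracket (primeP := primeP)).

Section Poisson.
Hypothesis poissonP : poisson_ideal P.

Local Notation br := (@quot_pbracket k R P primeP).
Let brE := quot_pbracketE primeP poissonP.
Let res_ind (T : prime_quot primeP -> Prop) :
  (forall a, T (residue primeP a)) -> forall x, T x.
Proof. by move=> Tr x; rewrite -(residue_repr x). Qed.

Let brDl a b c : br (a + b) c = br a c + br b c.
Proof.
elim/res_ind: a => a; elim/res_ind: b => b; elim/res_ind: c => c.
by rewrite -residueD !brE pbracketDl residueD.
Qed.

Let residue0 : residue primeP 0 = 0.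
Proof.
have := residueD primeP 0 0.
by rewrite addr0 -[X in X = _]addr0 => /addrI.
Qed.

Let br_alt a : br a a = 0.
Proof. by elim/res_ind: a => a; rewrite brE pbracketxx residue0. Qed.

Let brC a b : br a b = - br b a.
Proof.
elim/res_ind: a => a; elim/res_ind: b => b; apply/eqP.
by rewrite !brE -addr_eq0 -residueD pbracketC addNr residue0.
Qed.

Let brM a b c : br a (b * c) = br a b * c + b * br a c.
Proof.
elim/res_ind: a => a; elim/res_ind: b => b; elim/res_ind: c => c.
by rewrite -residueM !brE pbracket_leibniz residueD !residueM.
Qed.

Let br_jacobi a b c : br a (br b c) + br b (br c a) + br c (br a b) = 0.
Proof.
elim/res_ind: a => a; elim/res_ind: b => b; elim/res_ind: c => c.
by rewrite !brE -!residueD pbracket_jacobi residue0.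
Qed.

Lemma fract_pbracketE a b :
  fract_pbracket (to_fract a) (to_fract b) = to_fract (pbracket a b).
Proof.
by rewrite /fract_pbracket /to_fract (frac_pbracket_tofrac brC brM) brE.
Qed.

Lemma fract_pbracketDr x y z :
  fract_pbracket x (y + z) = fract_pbracket x y + fract_pbracket x z.
Proof. exact: frac_pbracketDr brDl brC brM _ _ _. Qed.

Lemma fract_pbracketxx x : fract_pbracket x x = 0.
Proof. exact: frac_pbracketxx br_alt brC brM _. Qed.

Lemma fract_pbracketC x y : fract_pbracket x y = - fract_pbracket y x.
Proof. exact: frac_pbracketC brC brM _ _. Qed.

Lemma fract_pbracket_leibniz x y z :
  fract_pbracket x (y * z) = fract_pbracket x y * z + y * fract_pbracket x z.
Proof. exact: frac_pbracket_leibniz brC brM _ _ _. Qed.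

Lemma fract_pbracket_jacobi x y z :
  fract_pbracket x (fract_pbracket y z) + fract_pbracket y (fract_pbracket z x)
    + fract_pbracket z (fract_pbracket x y) = 0.
Proof. exact: frac_pbracket_jacobi brDl brC brM _ _ _ br_jacobi. Qed.

Lemma fract_pbracket_scalar l x : fract_pbracket x (scalar_to_fract l) = 0.
Proof.
have P1 a : pbracket a 1 = 0 :> R.
  by have := pbracket_leibniz a 1 1; rewrite !mulr1 mul1r -[X in X = _]addr0
    => /addrI.
have a0 a : fract_pbracket (to_fract a) (scalar_to_fract l) = 0.
  rewrite fract_pbracketE pbracketZr P1 scaler0 /to_fract residue0.
  exact: tofrac0.
rewrite fract_pbracketC; apply/eqP; rewrite oppr_eq0; apply/eqP.
set y := scalar_to_fract l.
have y0 u : fract_pbracket y (FracField.tofrac u) = 0.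
  by elim/res_ind: u => u; rewrite fract_pbracketC a0 oppr0.
have [d0 xE] := frac_repr x.
have D0 : FracField.tofrac \d_(repr x) != 0 by rewrite tofrac_eq0.
have := fract_pbracket_leibniz y x (FracField.tofrac \d_(repr x)).
rewrite {1}xE divfK // !y0 mulr0 addr0 => /esym/eqP.
by rewrite mulf_eq0 (negPf D0) orbF => /eqP.
Qed.

End Poisson.

End FractQuotient.

Section Torus.
Variable k : fieldType.

Record kstar := Kstar { kstar_val :> k; kstar_neq0 : kstar_val != 0 }.

HB.instance Definition _ := [isSub for kstar_val].
HB.instance Definition _ := [Choice of kstar by <:].

Let one_kstar := Kstar (oner_neq0 k).
Let mul_kstar (x y : kstar) :=
  Kstar (mulf_neq0 (kstar_neq0 x) (kstar_neq0 y)).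
Let inv_kstar (x : kstar) :=
  @Kstar (x : k)^-1 (etrans (congr1 negb (invr_eq0 (x : k))) (kstar_neq0 x)).

Let mul_kstarA : associative mul_kstar.
Proof. by move=> x y z; apply/val_inj/mulrA. Qed.
Let mul1_kstar : left_id one_kstar mul_kstar.
Proof. by move=> x; apply/val_inj/mul1r. Qed.
Let mul_kstar1 : right_id one_kstar mul_kstar.
Proof. by move=> x; apply/val_inj/mulr1. Qed.
Let mulV_kstar : left_inverse one_kstar inv_kstar mul_kstar.
Proof. by move=> x; apply/val_inj/mulVf/kstar_neq0. Qed.
Let mul_kstarV : right_inverse one_kstar inv_kstar mul_kstar.
Proof. by move=> x; apply/val_inj/mulfV/kstar_neq0. Qed.

HB.instance Definition _ := isGroup.Build kstar
  mul_kstarA mul1_kstar mul_kstar1 mulV_kstar mul_kstarV.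

(* The group law is the componentwise one of {ffun _ -> _}. *)
Definition torus (r : nat) := {ffun 'I_r -> kstar}.

(* The coordinate ring of (k^x)^r is the ring of Laurent polynomials in the r
   coordinates, here given as lists of (coefficient, exponents) pairs. *)
Definition regular_function r (f : torus r -> k) :=
  exists s : seq (k * ('I_r -> int)), forall h,
    f h = \sum_(m <- s) m.1 * \prod_i (val (h i)) ^ m.2 i.

(* A map to k^x is a morphism of varieties when both its value and the inverse
   of its value are regular functions. *)
Definition rational_character r (f : torus r -> kstar) :=
  [/\ forall g h, f (g * h)%g = (f g * f h)%g,
      regular_function (fun h => val (f h)) &
      regular_function (fun h => (val (f h))^-1)].

End Torus.

Section TorusAction.
Variables (k : fieldType) (R : poissonAlgType k) (r : nat).
Local Notation H := (torus k r).
Variable act : H -> R -> R.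

Record poisson_torus_action : Prop := PoissonTorusAction {
  tact1 : forall x, act 1%g x = x;
  tactM : forall g h x, act (g * h)%g x = act g (act h x);
  tact_linear : forall h, linear (act h);
  tact_monoid_morphism : forall h, monoid_morphism (act h);
  tact_pbracket : forall h x y,
    act h (pbracket x y) = pbracket (act h x) (act h y)
}.

Definition eigenspace (f : H -> kstar k) : set R :=
  [set v | forall h, act h v = val (f h) *: v].

Definition eigenvector (v : R) :=
  v != 0 /\ forall h, exists c : k, act h v = c *: v.

Definition eigenvalue (f : H -> kstar k) := exists2 v, v != 0 & eigenspace f v.

(* R is the direct sum of its eigenspaces: they span R and are independent. *)
Definition rational_action :=
  [/\ forall v : R, exists2 s : seq R,
        (forall w, w \in s -> eigenvector w) & v = \sum_(w <- s) w,
      forall n (f : 'I_n -> H -> kstar k) (v : 'I_n -> R),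
        injective f -> (forall i, eigenspace (f i) (v i)) ->
        \sum_i v i = 0 -> forall i, v i = 0 &
      forall f, eigenvalue f -> rational_character f].

Definition H_ideal (I : set R) := is_ideal I /\ forall h, act h @` I = I.

(* (I : H) *)
Definition H_core (I : set R) : set R := \bigcap_h (act h @` I).

Definition prime_poisson_H_ideal (J : set R) :=
  [/\ prime_ideal J, poisson_ideal J & H_ideal J].

Definition H_stratum (J : set R) : set (pspec R) :=
  [set P | H_core P = J].

End TorusAction.

(* Main.v *)
Require Import Defs.
From HB Require Import structures.
From mathcomp Require Import all_boot all_order all_algebra.
From mathcomp Require Import fraction ring zify.
From mathcomp Require Import all_classical topology_structure.

Set Implicit Arguments.
Unset Strict Implicit.
Unset Printing Implicit Defensive.

Import GRing.Theory.
Local Open Scope classical_set_scope.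
Local Open Scope ring_scope.

(** The equivalence is proved around the cycle (a) => (b) => (c) => (d) => (a).

    (a) => (b): by the Jacobson property, an element that is not in P avoids
    some maximal ideal M containing P; the Poisson core of M is then a point of
    any neighborhood of P given by that element, and it contains P.

    (b) => (c): let P be the core of M and z Poisson central in Fract R/P.  The
    denominators of z form a Poisson ideal that is not contained in P, hence not
    in M, so z has a value in R/M, which is algebraic over k.  For a polynomial
    q killing this value, the elements of R that are q(z)-multiples of elements
    of R form a Poisson ideal contained in M, hence in P, so q(z) = 0.

    (c) => (d): if P is properly contained in Q in the same stratum, a quotient
    of an element of Q with few eigenvector summands by one of these summands is
    Poisson central in Fract R/P; it is zero modulo Q, hence not algebraic.

    (d) => (a): (Q : H) is a prime Poisson H-ideal for each Q in P.spec R, so P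
    is cut out among the Q containing it by the non-vanishing of one element
    lying in each of the finitely many prime Poisson H-ideals that are not
    contained in P. *)

(** * Noetherian rings and the Hilbert basis theorem *)

Section Noetherian.
Variable R : comNzRingType.
Implicit Types (I : set R) (s : seq R).

(** An intersection of ideals, so that inclusions are checked on generators without writing linear
    combinations. *)
Definition ideal_span s : set R :=
  [set x | forall I, is_ideal I -> {in s, forall y, I y} -> I x].

Lemma ideal_span_ideal s : is_ideal (ideal_span s).
Proof.
split=> [I|x y Ix Iy I idI sI|a x Ix I idI sI]; first by case.
- by apply: (idealD idI); [apply: Ix|apply: Iy].
- by apply: (idealM idI); apply: Ix.
Qed.

Lemma mem_ideal_span s y : y \in s -> ideal_span s y.
Proof. by move=> ys I _; apply. Qed.

Lemma ideal_span_sub s I :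
  is_ideal I -> {in s, forall y, I y} -> ideal_span s `<=` I.
Proof. by move=> idI sI x; apply. Qed.

Lemma ideal_spanS s t : {subset s <= t} -> ideal_span s `<=` ideal_span t.
Proof.
move=> st; apply: ideal_span_sub (ideal_span_ideal t) _ => y /st.
exact: mem_ideal_span.
Qed.

Lemma idealN I x : is_ideal I -> I x -> I (- x).
Proof. by move=> idI Ix; rewrite -mulN1r; apply: idealM. Qed.

Lemma idealB I x y : is_ideal I -> I x -> I y -> I (x - y).
Proof. by move=> idI Ix Iy; apply: (idealD idI) => //; exact: idealN. Qed.

Lemma idealMr I a x : is_ideal I -> I x -> I (x * a).
Proof. by move=> idI Ix; rewrite mulrC; exact: idealM. Qed.

Lemma ideal_sum I (T : eqType) (r : seq T) (F : T -> R) :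
  is_ideal I -> {in r, forall i, I (F i)} -> I (\sum_(i <- r) F i).
Proof.
move=> idI rI; rewrite big_seq; apply: big_ind => //.
- exact: ideal0.
- by move=> x y; apply: idealD.
Qed.

Definition noetherian := forall I, is_ideal I ->
  exists2 s, {in s, forall y, I y} & I `<=` ideal_span s.

(** The union of the chain is an ideal, and its finitely many generators all lie in one term. *)
Lemma noetherian_chain (U : nat -> set R) : noetherian ->
  (forall n, is_ideal (U n)) -> (forall n, U n `<=` U n.+1) ->
  exists N, forall n, U n `<=` U N.
Proof.
move=> nR idU US.
have UW m n : (m <= n)%N -> U m `<=` U n.
  move=> /subnK <-; elim: (n - m)%N => [//|d IH]; rewrite addSn.
  exact: subset_trans IH (US _).
have idV : is_ideal (\bigcup_n U n).
  split; first by exists 0%N => //; exact: ideal0.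
  - move=> x y [m _ xm] [n _ yn]; exists (maxn m n) => //.
    by apply: idealD => //; [apply: UW xm; exact: leq_maxl
                            |apply: UW yn; exact: leq_maxr].
  - by move=> a x [m _ xm]; exists m => //; exact: idealM.
have [s sV Vs] := nR _ idV.
have [N sN] : exists N, {in s, forall y, U N y}.
  elim: s sV {Vs} => [|y s IH] sV; first by exists 0%N.
  have [m ms] : exists N, {in s, forall y, U N y}.
    by apply: IH => z zs; apply: sV; rewrite inE zs orbT.
  have [n _ yn] := sV y (mem_head _ _).
  exists (maxn m n) => z; rewrite inE => /orP[/eqP->|/ms].
    by apply: UW yn; exact: leq_maxr.
  by apply: UW; exact: leq_maxl.
exists N => n x xn; apply: (ideal_span_sub (idU N) sN).
by apply: Vs; exists n.
Qed.

Lemma noetherian_maximal (F : set (set R)) I0 : noetherian ->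
  (forall I, F I -> is_ideal I) -> F I0 ->
  exists2 I, F I & forall I', F I' -> I `<=` I' -> I' `<=` I.
Proof.
move=> nR idF FI0; apply: contrapT => noM.
(* The hypothesis on [I] stands under the existential so that [choice] gives a total function. *)
have next I : exists I', F I -> [/\ F I', I `<=` I' & ~ I' `<=` I].
  have [FI|] := pselect (F I); last by exists I.
  apply: contrapT => noI'; apply: noM; exists I => // I' FI' II'.
  by apply: contrapT => I'I; apply: noI'; exists I'.
have [S SP] := choice next.
pose U n := iter n S I0.
have FU n : F (U n).
  by elim: n => [//|n IH]; rewrite /U iterS; case: (SP _ IH).
have [N UN] : exists N, forall n, U n `<=` U N.
  apply: noetherian_chain => // n; first exact/idF.
  by rewrite /U iterS; case: (SP _ (FU n)).
by case: (SP _ (FU N)) => _ _; apply; exact: (UN N.+1).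
Qed.

Lemma noetherian_sequence (x : nat -> R) : noetherian ->
  exists N, ideal_span [seq x i | i <- iota 0 N] (x N).
Proof.
move=> nR.
have [] := @noetherian_chain (fun n => ideal_span [seq x i | i <- iota 0 n]) nR.
- by move=> n; exact: ideal_span_ideal.
- by move=> n; apply: ideal_spanS; rewrite -addn1 iotaD map_cat
    => y ys; rewrite mem_cat ys.
move=> N UN; exists N; apply: (UN N.+1); apply: mem_ideal_span.
by apply: map_f; rewrite mem_iota /=.
Qed.

End Noetherian.

(** Hilbert's argument: [f n] is taken in [I] of least size outside the span of its predecessors.
    Once the leading coefficient of [f N] lies in the ideal of the earlier ones, subtracting a
    suitable [g] in the span lowers the size of [f N] without entering the span. *)
Lemma noetherian_poly (A : comNzRingType) : noetherian A -> noetherian {poly A}.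
Proof.
move=> nA I idI; apply: contrapT => nfg.
have next (s : seq {poly A}) : exists f, {in s, forall y, I y} ->
    [/\ I f, ~ ideal_span s f &
        forall g, I g -> ~ ideal_span s g -> (size f <= size g)%N].
  have [sI|] := pselect ({in s, forall y, I y}); last by exists 0.
  have [f [If nsf]] : exists f, I f /\ ~ ideal_span s f.
    apply: contrapT => nof; apply: nfg; exists s => // f If.
    by apply: contrapT => nsf; apply: nof; exists f.
  pose p n := `[< exists f, [/\ I f, ~ ideal_span s f & size f = n] >].
  have exp : exists n, p n by exists (size f); apply/asboolP; exists f.
  case: (ex_minnP exp) => n /asboolP[g [Ig nsg sg]] nmin.
  exists g => _; split=> // h Ih nsh; rewrite sg; apply: nmin.
  by apply/asboolP; exists h.
have [F FP] := choice next.
pose fix S n := if n is n'.+1 then rcons (S n') (F (S n')) else [::].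
pose f n := F (S n).
have SE n : S n = [seq f i | i <- iota 0 n].
  elim: n => [//|n IH]; rewrite -addn1 iotaD map_cat -IH addn1 /= -cats1.
  by [].
have SI n : {in S n, forall y, I y}.
  elim: n => [//|n IH] y /=; rewrite mem_rcons inE => /orP[/eqP->|/IH //].
  by case: (FP _ IH).
have fP n := FP _ (SI n).
have sub m n : (m <= n)%N -> ideal_span (S m) `<=` ideal_span (S n).
  move=> mn; apply: ideal_spanS; rewrite !SE -(subnKC mn) iotaD map_cat => y ys.
  by rewrite mem_cat ys.
have sizef m n : (m <= n)%N -> (size (f m) <= size (f n))%N.
  move=> mn; have [_ _ /(_ (f n))] := fP m.
  have [If nf _] := fP n; apply => //.
  by move/(sub _ _ mn).
have [N lcN] := noetherian_sequence (fun n => lead_coef (f n)) nA.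
have [IfN nfN minN] := fP N; rewrite -/(f N) in IfN nfN minN.
set d := size (f N).
have idS := ideal_span_ideal (S N).
have d_gt0 : (0 < d)%N.
  rewrite lt0n size_poly_eq0; apply/eqP => f0; apply: nfN; rewrite f0.
  exact: ideal0.
(* Multiplying each earlier [f i] by a power of ['X] brings its leading coefficient to degree
   [d.-1], hence into [L]. *)
pose L : set A := [set c | exists g,
  [/\ ideal_span (S N) g, (size g <= d)%N & g`_d.-1 = c]].
have idL : is_ideal L.
  split.
  - by exists 0; rewrite size_poly0 coef0; split=> //; exact: ideal0.
  - move=> x y [g [Sg sg <-]] [h [Sh sh <-]]; exists (g + h).
    rewrite coefD; split=> //; first exact: (idealD idS).
    by rewrite (leq_trans (size_polyD _ _)) // geq_max sg.
  - move=> a x [g [Sg sg <-]]; exists (a *: g); rewrite coefZ; split=> //.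
      by rewrite -mul_polyC; exact: (idealM idS).
    exact: leq_trans (size_scale_leq _ _) sg.
have [g [Sg sg gd]] : L (lead_coef (f N)).
  apply: (ideal_span_sub idL _ lcN) => _ /mapP[i iN ->].
  rewrite mem_iota /= in iN.
  have [fi0|fi0] := eqVneq (f i) 0.
    by rewrite fi0 lead_coef0; exact: (ideal0 idL).
  have sid : (size (f i) <= d)%N by apply: sizef; lia.
  have si0 : (0 < size (f i))%N by rewrite lt0n size_poly_eq0.
  exists (f i * 'X^(d - size (f i))); split.
  - apply: (idealMr _ idS); apply: mem_ideal_span.
    by rewrite SE; apply: map_f; rewrite mem_iota.
  - by rewrite size_mulXn // subnK.
  - have e : (((d.-1 - (d - size (f i)))%N = (size (f i)).-1) *
        ((d.-1 < d - size (f i))%N = false))%type.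
      by move: sid si0 d_gt0; clear; split; lia.
    by rewrite coefMXn !e lead_coefE.
have sfg : (size (f N - g)%R <= d.-1)%N.
  apply/leq_sizeP => j; rewrite leq_eqVlt coefB => /orP[/eqP <-|].
    by rewrite gd lead_coefE subrr.
  rewrite prednK // => dj.
  by rewrite !nth_default ?subrr //; exact: leq_trans sg _.
suff dle : (d <= size (f N - g)%R)%N.
  by have := leq_trans dle sfg; rewrite leqNgt prednK // leqnn.
apply: minN => [|Sfg].
  by apply: idealB => //; apply: ideal_span_sub Sg => //; exact: SI.
by apply: nfN; rewrite -(subrK g (f N)); exact: (idealD idS).
Qed.

Lemma noetherian_image (A B : comNzRingType) (phi : {rmorphism A -> B}) :
  (forall y, exists x, phi x = y) -> noetherian A -> noetherian B.
Proof.
move=> surj nA I idI.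
have [|s sI Is] := nA [set x | I (phi x)].
  split=> /=; first by rewrite rmorph0; exact: ideal0.
  - by move=> x y Ix Iy; rewrite rmorphD; exact: idealD.
  - by move=> a x Ix; rewrite rmorphM; exact: idealM.
exists (map phi s) => [_ /mapP[x xs ->]|y Iy]; first exact: sI.
have idS := ideal_span_ideal (map phi s).
have [x xy] := surj y; rewrite -xy.
have /Is Sx : [set x | I (phi x)] x by rewrite /= xy.
apply: (Sx [set z | ideal_span (map phi s) (phi z)]); last first.
  by move=> z zs; apply: mem_ideal_span; exact: map_f.
split=> /=; first by rewrite rmorph0; exact: ideal0.
- by move=> u v Iu Iv; rewrite rmorphD; exact: (idealD idS).
- by move=> a u Iu; rewrite rmorphM; exact: (idealM idS).
Qed.

Lemma noetherian_field (k : fieldType) : noetherian k.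
Proof.
move=> I idI.
have [[x [Ix x0]]|noI] := pselect (exists x, I x /\ x != 0).
  exists [:: x] => [y|y _]; first by rewrite inE => /eqP->.
  rewrite -(divfK x0 y); apply: idealM (ideal_span_ideal _) _ _ _.
  exact: mem_ideal_span (mem_head _ _).
exists [::] => // y Iy.
have [->|y0] := eqVneq y 0; first exact: ideal0 (ideal_span_ideal _).
by case: noI; exists y.
Qed.

(** A surjection from an iterated polynomial ring over [k] is built by induction on the list of
    generators. *)
Lemma affine_noetherian (k : fieldType) (R : comAlgType k) :
  affine R -> noetherian R.
Proof.
move=> [s gens].
suff [A [nA [phi [phik phis]]]] : exists A : comNzRingType, noetherian A /\
    exists phi : {rmorphism A -> R}, (forall c : k, exists x, phi x = c%:A) /\
      {in s, forall y, exists x, phi x = y}.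
  apply: (noetherian_image (phi := phi)) nA => y; apply/asboolP.
  apply: (gens [pred y | `[< exists x, phi x = y >]]).
  - split=> [|c u v /asboolP[x <-] /asboolP[x' <-]|u v].
    + by apply/asboolP; exists 1; rewrite rmorph1.
    + have [a ea] := phik c; apply/asboolP; exists (a * x + x').
      by rewrite rmorphD rmorphM ea mulr_algl.
    + by move=> /asboolP[x <-] /asboolP[x' <-]; apply/asboolP; exists (x * x');
        rewrite rmorphM.
  - by move=> u /phis ?; apply/asboolP.
elim: s {gens} => [|x s [A [nA [phi [phik phis]]]]].
  exists k; split; first exact: noetherian_field.
  by exists (in_alg R); split=> // c; exists c.
exists {poly A}; split; first exact: noetherian_poly.
have cx : commr_rmorph phi x by move=> a; exact: mulrC.
exists (horner_morph cx); split=> [c|y].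
  by have [a <-] := phik c; exists a%:P; exact: horner_morphC.
rewrite inE => /orP[/eqP->|/phis[a <-]]; first by
  exists 'X; exact: horner_morphX.
by exists a%:P; exact: horner_morphC.
Qed.

(** * Zariski's lemma *)

Lemma poly_rmorph_ext (A B : comNzRingType) (f g : {rmorphism {poly A} -> B}) :
  (forall a, f a%:P = g a%:P) -> f 'X = g 'X -> f =1 g.
Proof.
move=> fgC fgX; elim/poly_ind => [|p c IH]; first by rewrite !rmorph0.
by rewrite !rmorphD !rmorphM /= IH fgC fgX.
Qed.

Section Zariski.
Variable L : fieldType.

Definition adjoin_eval (A : comNzRingType) (phi : {rmorphism A -> L}) (x : L) :
    {rmorphism {poly A} -> L} :=
  horner_morph (fun a => mulrC x (phi a)).

Lemma adjoin_evalE (A : comNzRingType) (phi : {rmorphism A -> L}) x p :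
  adjoin_eval phi x p = (map_poly phi p).[x].
Proof. by []. Qed.

Lemma adjoin_evalC (A : comNzRingType) (phi : {rmorphism A -> L}) x a :
  adjoin_eval phi x a%:P = phi a.
Proof. exact: horner_morphC. Qed.

Lemma adjoin_evalX (A : comNzRingType) (phi : {rmorphism A -> L}) x :
  adjoin_eval phi x 'X = x.
Proof. exact: horner_morphX. Qed.

(** Generation over the image of [phi] is meant as a ring, not merely as a field. *)
Definition ring_generates (A : comNzRingType) (phi : {rmorphism A -> L})
    (s : seq L) :=
  forall S : set L, S 1 -> (forall x y, S x -> S y -> S (x - y)) ->
    (forall x y, S x -> S y -> S (x * y)) ->
    (forall a, S (phi a)) -> {in s, forall y, S y} -> forall y, S y.

(* Unlike algebraicOver, this does not require phi to be injective. *)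
Definition algebraic_elt (A : comNzRingType) (phi : {rmorphism A -> L})
    (y : L) :=
  exists2 p : {poly A}, map_poly phi p != 0 & root (map_poly phi p) y.

Lemma integralOver_comp (A B : comNzRingType) (phi : {rmorphism A -> L})
    (psi : {rmorphism B -> L}) (c : {rmorphism A -> B}) y :
  (forall a, psi (c a) = phi a) -> integralOver phi y -> integralOver psi y.
Proof.
move=> cE [p pm py]; exists (map_poly c p); first exact: monic_map.
by rewrite -map_poly_comp (eq_map_poly (g := phi)).
Qed.

(** Since 1/a = b/(ab), substituting [b%:P * 'X] for ['X] transports equations over A[1/a] to
    A[1/(ab)]. *)
Lemma integral_adjoin_invM (A : comNzRingType) (phi : {rmorphism A -> L})
    a b y :
  phi a != 0 -> phi b != 0 ->
  integralOver (adjoin_eval phi (phi a)^-1) y ->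
  integralOver (adjoin_eval phi (phi (a * b))^-1) y.
Proof.
move=> a0 b0.
pose c : {rmorphism {poly A} -> {poly A}} :=
  horner_morph (fun c => mulrC (b%:P * 'X) c%:P).
apply: (integralOver_comp (c := c)) => p.
pose f : {rmorphism {poly A} -> L} := adjoin_eval phi (phi (a * b))^-1 \o c.
apply: (poly_rmorph_ext (f := f)) => [d|].
  by rewrite -[f _]/(adjoin_eval _ _ (c _)) [c _]horner_morphC !adjoin_evalC.
rewrite -[f _]/(adjoin_eval _ _ (c _)) [c _]horner_morphX [LHS]rmorphM.
rewrite adjoin_evalC !adjoin_evalX rmorphM.
by field; rewrite a0.
Qed.

(** An equation becomes monic once its leading coefficient is inverted. *)
Lemma algebraic_integral (A : comNzRingType) (phi : {rmorphism A -> L}) y :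
  algebraic_elt phi y ->
  exists2 a, phi a != 0 & integralOver (adjoin_eval phi (phi a)^-1) y.
Proof.
move=> [p p0 py]; set q := map_poly phi p in p0 py.
(* The index is the degree of [q], because [phi] may kill the leading coefficient of [p]. *)
have lq : lead_coef q = phi p`_(size q).-1 by rewrite lead_coefE coef_map.
exists p`_(size q).-1; first by rewrite -lq lead_coef_eq0.
have l0 : lead_coef q != 0 by rewrite lead_coef_eq0.
rewrite -lq; apply: (@integral_root_monic _ _ _ _ ((lead_coef q)^-1 *: q)).
- by rewrite monicE lead_coefZ mulVf.
- by rewrite rootZ ?invr_eq0.
- apply/integral_poly => i; rewrite coefZ coef_map.
  have -> : (lead_coef q)^-1 * phi p`_i
      = adjoin_eval phi (lead_coef q)^-1 ((p`_i)%:P * 'X).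
    by rewrite rmorphM adjoin_evalC adjoin_evalX mulrC.
  exact: integral_id.
Qed.

(** The product of the denominators of the generators serves for all of them, and integral elements
    form a ring. *)
Lemma generated_integral (A : comNzRingType) (phi : {rmorphism A -> L}) s :
  ring_generates phi s -> {in s, forall y, algebraic_elt phi y} ->
  exists2 a, phi a != 0 & forall y, integralOver (adjoin_eval phi (phi a)^-1) y.
Proof.
move=> gen alg.
have [a a0 sint] : exists2 a, phi a != 0 &
    {in s, forall y, integralOver (adjoin_eval phi (phi a)^-1) y}.
  elim: s {gen} alg => [_|x s IH alg].
    by exists 1; rewrite ?rmorph1 ?oner_eq0.
  have [|a a0 sint] := IH.
    by move=> y ys; apply: alg; rewrite inE ys orbT.
  have [b b0 xint] := algebraic_integral (alg x (mem_head _ _)).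
  exists (a * b) => [|y]; first by rewrite rmorphM mulf_neq0.
  rewrite inE => /orP[/eqP->|/sint].
    by rewrite mulrC; exact: integral_adjoin_invM.
  exact: integral_adjoin_invM.
exists a => //; apply: gen => //.
- exact: integral1.
- by move=> x y; exact: integral_sub.
- by move=> x y; exact: integral_mul.
- by move=> c; rewrite -(adjoin_evalC phi (phi a)^-1 c); exact: integral_id.
Qed.

(** For u = 1/b, a monic equation of degree n + 1 multiplied by b^n expresses u as a polynomial in b
    over [A]. *)
Lemma integral_inv_image (A : comNzRingType) (phi : {rmorphism A -> L}) b :
  integralOver phi (phi b)^-1 -> exists c, phi c = (phi b)^-1.
Proof.
have [->|b0] := eqVneq (phi b) 0; first by exists 0; rewrite rmorph0 invr0.
move=> [p pm]; rewrite /root horner_poly => /eqP.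
set u := (phi b)^-1.
case sp: (size p) => [|[|n]].
- by move/eqP: sp; rewrite size_poly_eq0 (negPf (monic_neq0 pm)).
- rewrite big_ord1 expr0 mulr1; move/monicP: pm; rewrite lead_coefE sp /= => ->.
  by move/eqP; rewrite rmorph1 oner_eq0.
rewrite big_ord_recr /=; have := monicP pm; rewrite lead_coefE sp /= => ->.
rewrite rmorph1 mul1r => /eqP; rewrite addrC addr_eq0 => /eqP uE.
exists (- \sum_(i < n.+1) p`_i * b ^+ (n - i)).
have -> : u = u ^+ n.+1 * phi b ^+ n.
  by rewrite exprS -mulrA -exprMn mulVf // expr1n mulr1.
rewrite uE rmorphN rmorph_sum mulNr mulr_suml; congr (- _).
apply: eq_bigr => i _; rewrite rmorphM rmorphXn /= -mulrA; congr (_ * _).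
have -> : phi b ^+ n = phi b ^+ i * phi b ^+ (n - i).
  by rewrite -exprD subnKC // -ltnS.
by rewrite mulrA -exprMn mulVf // expr1n mul1r.
Qed.

(* With g = 1 + Xw, integrality of 1/g over A[x][1/w] puts 1/g in A[x][1/w],
   so that g divides a power of w although g and w are coprime. *)
Lemma transcendental_not_integral (A : comNzRingType) (phi : {rmorphism A -> L})
    (x : L) (w : {poly A}) :
  ~ algebraic_elt phi x -> adjoin_eval phi x w != 0 ->
  ~ (forall y, integralOver
       (adjoin_eval (adjoin_eval phi x) (adjoin_eval phi x w)^-1) y).
Proof.
set psi := adjoin_eval phi x => trx w0 int.
have psi0 p : psi p = 0 -> map_poly phi p = 0.
  move=> p0; apply: contrapT => /eqP pn0; apply: trx; exists p => //.
  by rewrite /root -adjoin_evalE -/psi p0.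
set W := psi w in w0 int.
pose g : {poly A} := 1 + 'X * w.
pose wb := map_poly phi w.
have gE : map_poly phi g = 1 + 'X * wb.
  by rewrite rmorphD rmorphM rmorph1 /= map_polyX.
have wb0 : wb != 0.
  by apply: contraNneq w0 => wb0; rewrite /W /psi adjoin_evalE -/wb wb0 horner0.
have [c] : exists c, adjoin_eval psi W^-1 c = (psi g)^-1.
  rewrite -(adjoin_evalC psi W^-1 g); apply: integral_inv_image; exact: int.
(* A power of w clears the denominators of an element of A[x][1/w]. *)
have [u [N uE]] : exists u N, adjoin_eval psi W^-1 c * W ^+ N = psi u.
  elim/poly_ind: c => [|c d [u [N uE]]].
    by exists 0, 0%N; rewrite !rmorph0 mul0r.
  exists (u + d * w ^+ N.+1), N.+1.
  rewrite !rmorphD !rmorphM !rmorphXn adjoin_evalC adjoin_evalX -uE -/W.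
  by rewrite exprS; field.
move=> cE; have g0 : psi g != 0.
  apply/eqP => /psi0; rewrite gE => /polyP/(_ 0%N).
  by rewrite coefD coefXM coef1 coef0 addr0 => /eqP; rewrite oner_eq0.
have : psi (w ^+ N - g * u) = 0.
  by rewrite rmorphB rmorphM rmorphXn -uE cE -/W mulrA mulfV // mul1r subrr.
move/psi0; rewrite rmorphB rmorphM rmorphXn /= gE -/wb => /eqP.
rewrite subr_eq0 => /eqP wE.
have cop : coprimep (1 + 'X * wb) wb.
  apply/Bezout_coprimepP; exists (1, - 'X) => /=.
  by rewrite mul1r mulNr addrK eqpxx.
have dv : (1 + 'X * wb) %| wb ^+ N by rewrite wE dvdp_mulIl.
(* A divisor of a power of [wb] that is coprime to [wb] is coprime to itself, hence constant; but
   this one has positive degree. *)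
have : coprimep (1 + 'X * wb) (1 + 'X * wb).
  by apply: coprimep_dvdl dv _; rewrite coprimep_expr.
rewrite coprimepp addrC size_polyDl mulrC size_mulX // ?size_poly1 //.
  by rewrite eqSS size_poly_eq0 (negPf wb0).
by rewrite ltnS size_poly_gt0.
Qed.

(* A generator x that is transcendental over A is absorbed in the base ring:
   by induction L is algebraic over A[x], which was just excluded. *)
Lemma generated_algebraic_elt (t s : seq L) (A : comNzRingType)
    (phi : {rmorphism A -> L}) :
  ring_generates phi s ->
  {in s, forall y, y \notin t -> algebraic_elt phi y} ->
  {in s, forall y, algebraic_elt phi y}.
Proof.
(* [t] holds the candidates for transcendental generators; the base ring is generalized because it
   grows in the induction. *)
elim: t A phi => [|x t IH] A phi gen alg; first by move=> y ys; exact: alg.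
have [algx|trx] := pselect (algebraic_elt phi x).
  apply: IH => // y ys yt; have [->//|yx] := eqVneq y x.
  by apply: alg; rewrite ?inE ?negb_or ?yx.
exfalso.
have algS y : algebraic_elt phi y -> algebraic_elt (adjoin_eval phi x) y.
  move=> [p p0 py]; exists (map_poly polyC p);
  by rewrite -map_poly_comp (eq_map_poly (g := phi)) // => a;
    exact: adjoin_evalC.
have genS : ring_generates (adjoin_eval phi x) s.
  move=> S S1 SB SM Sphi Ss; apply: gen => // a.
  by rewrite -(adjoin_evalC phi x a).
have [y ys yt|w w0] := generated_integral genS (IH _ _ genS _).
  have [->|yx] := eqVneq y x.
    (* The inner ['X] is the variable of A[x], whose value is [x]. *)
    exists ('X - ('X)%:P); last first.
      by rewrite rmorphB /= map_polyX map_polyC /= adjoin_evalX root_XsubC.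
    by rewrite rmorphB /= map_polyX map_polyC /= monic_neq0 ?monicXsubC.
  by apply: algS; apply: alg; rewrite ?inE ?negb_or ?yx.
exact: transcendental_not_integral.
Qed.

(** With [t] equal to [s], no generator has to be known algebraic beforehand; the algebraic elements
    form a ring. *)
Lemma zariski_lemma (k : fieldType) (iota : {rmorphism k -> L}) s :
  ring_generates iota s -> forall y, algebraicOver iota y.
Proof.
move=> gen; apply: (gen) => //.
- exact: algebraic1.
- by move=> x y; exact: algebraic_sub.
- by move=> x y; exact: algebraic_mul.
- exact: algebraic_id.
have alg := @generated_algebraic_elt s s k iota gen.
move=> y ys; have [|p p0 py] := alg _ y ys; first by move=> z ->.
by exists p => //; apply: contraNneq p0 => ->; rewrite rmorph0.
Qed.

End Zariski.

(** * Fraction fields of prime quotients and the Nullstellensatz *)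

Section ToFract.
Variables (k : fieldType) (R : poissonAlgType k) (P : set R).
Variable primeP : prime_ideal P.

Lemma to_fract_zmod_morphism : zmod_morphism (to_fract primeP).
Proof.
have resD := residueD primeP; have res0 : residue primeP 0 = 0.
  by apply: (addrI (residue primeP 0)); rewrite -resD !addr0.
have resN x : residue primeP (- x) = - residue primeP x.
  by apply/eqP; rewrite -addr_eq0 -resD addNr res0.
by move=> x y; rewrite /to_fract resD resN rmorphB.
Qed.

Lemma to_fract_monoid_morphism : monoid_morphism (to_fract primeP).
Proof.
have resM := residueM primeP; split; last first.
  by move=> x y; rewrite /to_fract resM rmorphM.
have res1 : residue primeP 1 != 0.
  apply/eqP => res1; apply: (prime_ideal1 primeP).
  have idP := prime_idealP primeP.
  suff /residue_eq : residue primeP 1 = residue primeP 0.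
    by rewrite subr0; apply.
  rewrite res1; apply/esym/(addrI (residue primeP 0)).
  by rewrite -residueD !addr0.
rewrite /to_fract; have -> : residue primeP 1 = 1; last by rewrite rmorph1.
(* A nonzero idempotent of a domain is 1. *)
by apply: (mulfI res1); rewrite -resM !mulr1.
Qed.

HB.instance Definition _ := GRing.isZmodMorphism.Build R (fract primeP)
  (to_fract primeP) to_fract_zmod_morphism.
HB.instance Definition _ := GRing.isMonoidMorphism.Build R (fract primeP)
  (to_fract primeP) to_fract_monoid_morphism.

Lemma to_fract_eq0 a : to_fract primeP a = 0 <-> P a.
Proof.
rewrite -{2}[a]subr0 -(residue_eq primeP).
split=> [|e]; last first.
  by have := rmorph0 (to_fract primeP); rewrite /to_fract e.
rewrite -[in X in X -> _](rmorph0 (to_fract primeP)) => /eqP.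
by rewrite tofrac_eq => /eqP.
Qed.

Lemma to_fract_neq0 a : to_fract primeP a != 0 <-> ~ P a.
Proof. by rewrite -to_fract_eq0; split=> /eqP. Qed.

Lemma fract_frac (z : fract primeP) :
  exists a b, ~ P b /\ z = to_fract primeP a / to_fract primeP b.
Proof.
have [d0 zE] := frac_repr z.
exists (repr \n_(repr z)), (repr \d_(repr z)).
by rewrite -to_fract_neq0 /to_fract !residue_repr tofrac_eq0.
Qed.

Lemma scalar_to_fract_zmod_morphism : zmod_morphism (scalar_to_fract primeP).
Proof. by move=> x y; rewrite /scalar_to_fract scalerBl rmorphB. Qed.

Lemma scalar_to_fract_monoid_morphism :
  monoid_morphism (scalar_to_fract primeP).
Proof.
split=> [|x y]; rewrite /scalar_to_fract; first by rewrite scale1r rmorph1.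
by rewrite -rmorphM -scalerAl mul1r scalerA.
Qed.

HB.instance Definition _ := GRing.isZmodMorphism.Build k (fract primeP)
  (scalar_to_fract primeP) scalar_to_fract_zmod_morphism.
HB.instance Definition _ := GRing.isMonoidMorphism.Build k (fract primeP)
  (scalar_to_fract primeP) scalar_to_fract_monoid_morphism.

Lemma to_fractZ (c : k) a :
  to_fract primeP (c *: a) = scalar_to_fract primeP c * to_fract primeP a.
Proof. by rewrite /scalar_to_fract -rmorphM /= mulr_algl. Qed.

End ToFract.

(** All factors ['X] can be divided out of an equation of a nonzero element. *)
Lemma algebraic_coef0 (F E : fieldType) (iota : {rmorphism F -> E}) u :
  u != 0 -> algebraicOver iota u ->
  exists2 q : {poly F}, q`_0 != 0 & root (map_poly iota q) u.
Proof.
move=> u0 [p p0 pu].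
have [m [q]] := multiplicity_XsubC p 0; rewrite p0 /= subr0 => q0 pE.
exists q; first by rewrite -horner_coef0.
move: pu; rewrite pE rmorphM rmorphXn /= map_polyX rootM => /orP[//|].
by rewrite /root hornerXn expf_eq0 (negPf u0) andbF.
Qed.

Section MaximalIdeals.
Variable R : comNzRingType.
Implicit Types I P M : set R.

Definition ideal_adjoin I b : set R :=
  [set x | exists m c, I m /\ x = m + c * b].

Lemma ideal_adjoin_ideal I b : is_ideal I -> is_ideal (ideal_adjoin I b).
Proof.
move=> idI; split.
- by exists 0, 0; rewrite mul0r addr0; split=> //; exact: ideal0.
- move=> x y [m [c [Im ->]]] [n [d [In ->]]]; exists (m + n), (c + d).
  by split; [exact: idealD | ring].
- move=> a x [m [c [Im ->]]]; exists (a * m), (a * c).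
  by split; [exact: idealM | ring].
Qed.

Lemma ideal_adjoin_sub I b : I `<=` ideal_adjoin I b.
Proof. by move=> x Ix; exists x, 0; rewrite mul0r addr0. Qed.

Lemma ideal_adjoin_mem I b : is_ideal I -> ideal_adjoin I b b.
Proof.
by move=> idI; exists 0, 1; rewrite mul1r add0r; split=> //; exact: ideal0.
Qed.

(** The criterion that R/M is a field, stated without the quotient. *)
Lemma maximal_idealP_inv M : is_ideal M -> ~ M 1 ->
  (maximal_ideal M <-> forall b, ~ M b -> exists c, M (1 - c * b)).
Proof.
move=> idM M1; split=> [[_ _ maxM] b Mb|inv].
  have [[m [c [Mm e]]]|I1] := pselect (ideal_adjoin M b 1).
    by exists c; rewrite e addrK.
  case: Mb; rewrite -(maxM _ _ I1 (@ideal_adjoin_sub _ _)).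
    exact: ideal_adjoin_mem.
  exact: ideal_adjoin_ideal.
split=> // I idI I1 MI; apply/seteqP; split=> // b Ib; apply: contrapT => Mb.
have [c /MI Ic] := inv b Mb; apply: I1; rewrite -(subrK (c * b) 1).
by apply: idealD => //; exact: idealM.
Qed.

Lemma maximal_prime M : maximal_ideal M -> prime_ideal M.
Proof.
move=> maxM; have [idM M1 _] := maxM.
split=> // x y Mxy; apply: contrapT => /not_orP[Mx My].
have /(maximal_idealP_inv idM M1) inv := maxM; have [c Mc] := inv x Mx.
apply: My; have -> : y = y * (1 - c * x) + c * (x * y) by ring.
by apply: idealD => //; apply: idealM.
Qed.

End MaximalIdeals.

Section Nullstellensatz.
Variables (k : fieldType) (R : poissonAlgType k).
Implicit Types P M : set R.

Lemma horner_alg_to_fract P (primeP : prime_ideal P) (b : R) (q : {poly k}) :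
  to_fract primeP (horner_alg b q)
    = (map_poly (scalar_to_fract primeP) q).[to_fract primeP b].
Proof.
rewrite -(adjoin_evalE (scalar_to_fract primeP)).
pose f : {rmorphism {poly k} -> fract primeP} :=
  to_fract primeP \o horner_alg b.
apply: (poly_rmorph_ext (f := f)) => [c|].
  by rewrite adjoin_evalC /f /= horner_algC.
by rewrite adjoin_evalX /f /= horner_algX.
Qed.

(** Generators of [R] together with [extra] generate Fract R/P over [k], so Zariski's lemma
    applies. *)
Lemma affine_fract_algebraic P (primeP : prime_ideal P) extra :
  affine R -> ring_generates (to_fract primeP) extra ->
  forall y, algebraicOver (scalar_to_fract primeP) y.
Proof.
move=> [s gens] gen.
apply: (@zariski_lemma _ _ _ (map (to_fract primeP) s ++ extra)).
move=> S S1 SB SM Sk Ss; apply: gen => // [a|y ye]; last first.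
  by apply: Ss; rewrite mem_cat ye orbT.
have S0 : S 0 by rewrite -(subrr 1); exact: SB.
have SD x y : S x -> S y -> S (x + y).
  by move=> Sx Sy; rewrite -(opprK y) -(sub0r y); do ?apply: (SB).
apply/asboolP; apply: (gens [pred x | `[< S (to_fract primeP x) >]]).
- split=> [|c u v /asboolP Su /asboolP Sv|u v /asboolP Su /asboolP Sv].
  + by apply/asboolP; rewrite rmorph1.
  + apply/asboolP; rewrite rmorphD /= to_fractZ; apply: (SD) => //.
    by apply: (SM) => //; exact: Sk.
  + by apply/asboolP; rewrite rmorphM; apply: SM.
- by move=> x xs; apply/asboolP/Ss; rewrite mem_cat map_f.
Qed.

Lemma maximal_residue_algebraic M (maxM : maximal_ideal M) y : affine R ->
  algebraicOver (scalar_to_fract (maximal_prime maxM)) y.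
Proof.
move=> affR.
apply: (affine_fract_algebraic (extra := [::])) => // S _ _ SM SR _ z.
have [a [b [Mb ->]]] := fract_frac z; apply: (SM); first exact: SR.
have [idM M1 _] := maxM.
have /(maximal_idealP_inv idM M1) inv := maxM; have [c Mc] := inv b Mb.
suff -> : (to_fract (maximal_prime maxM) b)^-1
    = to_fract (maximal_prime maxM) c.
  exact: SR.
move/(to_fract_eq0 (maximal_prime maxM)): Mc; rewrite rmorphB rmorph1 rmorphM.
move/to_fract_neq0: Mb => /(_ (maximal_prime maxM)) b0 /eqP; rewrite subr_eq0.
by move=> /eqP e; apply: (mulIf b0); rewrite mulVf.
Qed.

(** Let p be maximal among the ideals that contain [P] and no power of [f]. It is prime, and every
    element outside p divides a power of [f] modulo p, so Fract R/p is (R/p)[1/f]. Zariski's lemma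
    makes it algebraic over [k]; then R/p is a field. *)
Lemma prime_avoid_maximal P f : affine R -> prime_ideal P -> ~ P f ->
  exists M, [/\ maximal_ideal M, P `<=` M & ~ M f].
Proof.
move=> affR primeP Pf.
pose F := [set I | [/\ is_ideal I, P `<=` I & forall n, ~ I (f ^+ n)]].
have [||p [idp Pp pf] pmax] :=
  @noetherian_maximal _ F P (affine_noetherian affR).
- by move=> I [].
- have [idP P1 PM] := primeP; split=> // n; elim: n => [//|n IH].
  by rewrite exprS => /PM[].
have pmax_adj b : ~ p b -> exists n c, p (f ^+ n - c * b).
  move=> pb; apply: contrapT => nof.
  have /pmax : F (ideal_adjoin p b).
    split; first exact: ideal_adjoin_ideal.
      exact: subset_trans Pp (@ideal_adjoin_sub _ _ _).
    by move=> n [m [c [pm e]]]; apply: nof; exists n, c; rewrite e addrK.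
  move=> /(_ (@ideal_adjoin_sub _ _ _)) /(_ b) H.
  by apply: pb; apply: H; exact: ideal_adjoin_mem.
have primep : prime_ideal p.
  split=> //; first by have := pf 0%N.
  move=> x y pxy; apply: contrapT => /not_orP[px py].
  have [m [c pc]] := pmax_adj x px; have [n [d pd]] := pmax_adj y py.
  apply: (pf (m + n)%N); rewrite exprD.
  have -> : f ^+ m * f ^+ n = f ^+ n * (f ^+ m - c * x)
     + c * x * (f ^+ n - d * y) + c * d * (x * y) by ring.
  by do ?apply: (idealD idp); apply: idealM.
have pf1 : ~ p f by have := pf 1%N; rewrite expr1.
exists p; split=> //.
set phi := to_fract primep.
have phif : phi f != 0 by exact/to_fract_neq0.
have alg : forall y, algebraicOver (scalar_to_fract primep) y.
  apply: (affine_fract_algebraic (extra := [:: (phi f)^-1])) => //.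
  move=> S S1 _ SM SR Sf z; have [a [b [pb ->]]] := fract_frac z.
  have Sfn n : S ((phi f)^-1 ^+ n).
    elim: n => [//|n IH]; rewrite exprS; apply: (SM) => //.
    by apply: Sf; rewrite mem_head.
  have [n [c /(to_fract_eq0 primep)]] := pmax_adj b pb.
  move/(to_fract_neq0 primep): pb => b0.
  rewrite rmorphB rmorphM rmorphXn => /eqP; rewrite subr_eq0 => /eqP e.
  apply: (SM); first exact: SR.
  have -> : (phi b)^-1 = phi c * (phi f)^-1 ^+ n.
    apply: (mulIf b0).
    by rewrite (mulVf b0) mulrAC -e -exprMn (mulfV phif) expr1n.
  exact: SM (SR c) (Sfn n).
have [idp' p1 _] := primep.
apply/maximal_idealP_inv => // b pb.
have b0 : phi b != 0 by exact/to_fract_neq0.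
have [q q0] := algebraic_coef0 b0 (alg (phi b)).
rewrite /root -horner_alg_to_fract => /eqP/to_fract_eq0.
(* Modulo p the equation reads r(b) b = - q_0 with q_0 nonzero, which inverts b. *)
have -> : q = drop_poly 1 q * 'X + (q`_0)%:P.
  rewrite addrC -[LHS](poly_take_drop 1) expr1; congr (_ + _).
  by apply/polyP => i; rewrite coef_take_poly coefC; case: i.
set r := drop_poly 1 q.
rewrite rmorphD rmorphM /= horner_algC horner_algX => pq.
exists (- ((q`_0)^-1 *: horner_alg b r)).
have -> : 1 - - ((q`_0)^-1 *: horner_alg b r) * b
    = (q`_0)^-1 %:A * (horner_alg b r * b + (q`_0)%:A).
  rewrite mulrDr !mulr_algl scalerA mulVf // scale1r mulNr opprK addrC.
  by rewrite scalerAl.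
exact: idealM.
Qed.

End Nullstellensatz.

(** * Poisson-prime ideals and Poisson cores *)

Section PoissonIdealTheory.
Variables (k : fieldType) (R : poissonAlgType k).
Hypothesis char0 : [pchar k] =i pred0.
Implicit Types (a x y : R) (I Q M : set R).

Lemma pbracketMr a x y :
  pbracket a (x * y) = pbracket a x * y + x * pbracket a y.
Proof. exact: pbracket_leibniz. Qed.

Lemma pbracketr0 a : pbracket a 0 = 0 :> R.
Proof. by rewrite -[X in pbracket a X](subrr 0) pbracketBr subrr. Qed.

Lemma pbracketr1 a : pbracket a 1 = 0 :> R.
Proof.
have := pbracketMr a 1 1; rewrite !mulr1 mul1r -[X in X = _]addr0.
by move/addrI.
Qed.

Lemma pbracketXS a x n :
  pbracket a (x ^+ n.+1) = (x ^+ n * pbracket a x) *+ n.+1.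
Proof.
elim: n => [|n IH]; first by rewrite expr1 expr0 mul1r.
by rewrite exprS pbracketMr IH exprS; ring.
Qed.

Lemma mulr_pbracketX a x n :
  x * pbracket a (x ^+ n) = (x ^+ n * pbracket a x) *+ n.
Proof.
case: n => [|n]; first by rewrite expr0 pbracketr1 mulr0.
by rewrite pbracketXS exprS; ring.
Qed.

Lemma ideal_mulrn I x n : is_ideal I -> I x -> I (x *+ n).
Proof. by move=> idI Ix; rewrite -mulr_natl; exact: idealM. Qed.

Lemma ideal_mulrnS I x n : is_ideal I -> I (x *+ n.+1) -> I x.
Proof.
move=> idI Ix; have n0 : n.+1%:R != 0 :> k by have /pcharf0P -> := char0.
have -> : x = ((n.+1%:R : k)^-1 %:A) * (x *+ n.+1).
  by rewrite mulr_algl -scaler_nat scalerA mulVf // scale1r.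
exact: idealM.
Qed.

Definition colon_ideal Q I : set R := [set y | forall x, I x -> Q (y * x)].

Lemma colon_ideal_poisson Q I :
  poisson_ideal Q -> poisson_ideal I -> poisson_ideal (colon_ideal Q I).
Proof.
move=> [idQ pQ] [idI pI]; split; first split.
- by move=> x _; rewrite mul0r; exact: ideal0.
- by move=> y z Qy Qz x Ix; rewrite mulrDl; apply: idealD => //; auto.
- by move=> a y Qy x Ix; rewrite -mulrA; apply: idealM => //; auto.
- move=> a y Qy x Ix.
  have -> : pbracket a y * x = pbracket a (y * x) - y * pbracket a x.
    by rewrite pbracketMr addrK.
  by apply: idealB => //; [apply/pQ/Qy | apply/Qy/pI].
Qed.

Definition saturation Q y : set R := [set x | exists N, Q (y ^+ N * x)].

(** One more factor [y] absorbs the term in which the bracket falls on the power of [y]. *)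
Lemma saturation_poisson Q y :
  poisson_ideal Q -> poisson_ideal (saturation Q y).
Proof.
move=> [idQ pQ]; split; first split.
- by exists 0%N; rewrite mulr0; exact: ideal0.
- move=> u v [m Qu] [n Qv]; exists (m + n)%N.
  have -> : y ^+ (m + n) * (u + v)
      = y ^+ n * (y ^+ m * u) + y ^+ m * (y ^+ n * v) by rewrite exprD; ring.
  by apply: idealD => //; apply: idealM.
- by move=> a x [N Qx]; exists N; rewrite mulrCA; apply: idealM.
- move=> a x [N Qx]; exists N.+1.
  have -> : y ^+ N.+1 * pbracket a x = pbracket a (y ^+ N.+1 * x)
      - N.+1%:R * pbracket a y * (y ^+ N * x).
    by rewrite pbracketMr pbracketXS; ring.
  apply: idealB => //; last exact: idealM.
  by apply: pQ; rewrite exprS -mulrA; apply: idealM.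
Qed.

Definition radical Q : set R := [set y | exists n, Q (y ^+ n)].

(** With d = {a,y}, bracketing y^(m+1) d^i with a and multiplying by d gives (m+1) y^m d^(i+2) up to
    a multiple of y^(m+1) d^i. Repeating this trades all factors y for factors d. *)
Lemma radical_pbracket Q a y : poisson_ideal Q -> radical Q y ->
  radical Q (pbracket a y).
Proof.
move=> [idQ pQ] [m]; rewrite -[_ ^+ m]mulr1 -(expr0 (pbracket a y)).
set d := pbracket a y; elim: m 0%N => [|m IH] i Qi.
  by exists i; rewrite expr0 mul1r in Qi.
apply: (IH i.+2); apply: (@ideal_mulrnS _ _ m idQ).
have -> : (y ^+ m * d ^+ i.+2) *+ m.+1
    = d * pbracket a (y ^+ m.+1 * d ^+ i)
      - (pbracket a d *+ i) * (y ^+ m.+1 * d ^+ i).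
  rewrite pbracketMr pbracketXS mulrDr [d * (y ^+ m.+1 * _)]mulrCA.
  by rewrite mulr_pbracketX -/d !exprS; ring.
by apply: idealB => //; apply: idealM => //; exact: pQ.
Qed.

Lemma radical_ideal Q : is_ideal Q -> is_ideal (radical Q).
Proof.
move=> idQ; split.
- by exists 1%N; rewrite expr1; exact: ideal0.
- move=> x y [m Qx] [n Qy]; exists (m + n)%N; rewrite exprDn.
  apply: ideal_sum => // i _; apply: ideal_mulrn => //.
  have [ni|ni] := leqP n i.
    apply: idealM => //; rewrite -(subnK ni) exprD; exact: idealM.
  apply: idealMr => //.
  have -> : (m + n - i = n - i + m)%N by lia.
  by rewrite exprD; apply: idealM.
- by move=> a x [n Qx]; exists n; rewrite exprMn; apply: idealM.
Qed.

(* Q is primary, because the elements killed modulo Q by a power of y form a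
   Poisson ideal; and Q is radical, because in characteristic zero its radical
   is a Poisson ideal, which is annihilated modulo Q by some u outside Q. *)
Lemma poisson_prime_prime Q : noetherian R -> poisson_prime Q -> prime_ideal Q.
Proof.
move=> nR [poisQ Q1 primeQ]; have [idQ pQ] := poisQ.
have primary y a : Q (y * a) -> ~ Q a -> radical Q y.
  move=> Qya Qa; have poisT := saturation_poisson y poisQ.
  have [idT _] := poisT.
  have [s sT Ts] := nR _ idT.
  (* Finite generation provides one exponent for the whole saturation. *)
  have [N QN] : exists N, {in s, forall x, Q (y ^+ N * x)}.
    elim: s sT {Ts} => [|x s IH] sT; first by exists 0%N.
    have [N QN] : exists N, {in s, forall x, Q (y ^+ N * x)}.
      by apply: IH => z zs; apply: sT; rewrite inE zs orbT.
    have [M QM] := sT x (mem_head _ _).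
    exists (M + N)%N => z; rewrite inE exprD => /orP[/eqP->|/QN].
      by rewrite mulrAC; apply: idealMr.
    by rewrite -mulrA; apply: idealM.
  exists N; have [cQ|TQ] := primeQ _ _ (colon_ideal_poisson poisQ poisT) poisT
    (fun x z cx => @cx z); last first.
    by case: Qa; apply: TQ; exists 1%N; rewrite expr1.
  apply: cQ => x /Ts /(_ [set x | Q (y ^+ N * x)]); apply => //.
  split=> /=; first by rewrite mulr0; exact: ideal0.
  - by move=> u v; rewrite mulrDr; exact: idealD.
  - by move=> b u Qu; rewrite mulrCA; exact: idealM.
have radQ : radical Q `<=` Q.
  have poisN : poisson_ideal (radical Q).
    by split; [exact: radical_ideal | move=> a x; exact: radical_pbracket].
  have [s sN Ns] := nR _ (radical_ideal idQ).
  (* For each generator in turn, [u] is multiplied by the highest power that keeps it outside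
     [Q]. *)
  have [u [Qu us]] : exists u, ~ Q u /\ {in s, forall y, Q (u * y)}.
    elim: s sN {Ns} => [|y s IH] sN; first by exists 1.
    have [u [Qu us]] : exists u, ~ Q u /\ {in s, forall y, Q (u * y)}.
      by apply: IH => z zs; apply: sN; rewrite inE zs orbT.
    have exN : exists N, `[< Q (u * y ^+ N) >].
      have [N QN] := sN y (mem_head _ _).
      by exists N; apply/asboolP; apply: idealM.
    case: (ex_minnP exN) => [[|N]] /asboolP QN Nmin.
      by rewrite expr0 mulr1 in QN.
    exists (u * y ^+ N); split.
      by move=> /asboolP /Nmin; rewrite ltnn.
    move=> z; rewrite inE => /orP[/eqP->|/us Quz].
      by rewrite -mulrA -exprSr.
    by rewrite mulrAC; apply: idealMr.
  have [cQ|//] := primeQ _ _ (colon_ideal_poisson poisQ poisN) poisN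
    (fun x z cx => @cx z).
  case: Qu; apply: cQ => x /Ns /(_ [set x | Q (u * x)]); apply => //.
  split=> /=; first by rewrite mulr0; exact: ideal0.
  - by move=> v w; rewrite mulrDr; exact: idealD.
  - by move=> b v Qv; rewrite mulrCA; exact: idealM.
split=> // x y Qxy; have [Qy|Qy] := pselect (Q y); first by right.
by left; apply: radQ; exact: primary Qxy Qy.
Qed.

Definition poisson_core M : set R :=
  [set x | exists I, [/\ poisson_ideal I, I `<=` M & I x]].

(** The union of the Poisson ideals inside [M] is additively closed because the sum of two of them
    is another one. *)
Lemma poisson_coreP M : is_ideal M -> is_poisson_core M (poisson_core M).
Proof.
move=> idM; split; last by move=> I pI IM x Ix; exists I.
- split; first split.
  + exists [set 0]; split=> //; last by move=> _ ->; exact: ideal0.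
    split; last by move=> a x /= ->; exact: pbracketr0.
    by split=> //= [x y -> ->|a x ->]; rewrite ?addr0 ?mulr0.
  + move=> x y [I [[idI pI] IM Ix]] [J [[idJ pJ] JM Jy]].
    exists [set z | exists u v, [/\ I u, J v & z = u + v]]; split.
    * split; first split.
      - by exists 0, 0; rewrite addr0; split=> //; exact: ideal0.
      - move=> z w [u [v [Iu Jv ->]]] [u' [v' [Iu' Jv' ->]]].
        by exists (u + u'), (v + v'); split; [exact: idealD..|ring].
      - move=> a z [u [v [Iu Jv ->]]]; exists (a * u), (a * v).
        by split; [exact: idealM..|ring].
      - move=> a z [u [v [Iu Jv ->]]].
        exists (pbracket a u), (pbracket a v).
        by rewrite pbracketDr; split; auto.
    * by move=> z [u [v [/IM Mu /JM Mv ->]]]; exact: idealD.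
    * by exists x, y.
  + move=> a x [I [pI IM Ix]]; exists I; split=> //.
    by apply: idealM => //; case: pI.
  + by move=> a x [I [pI IM Ix]]; exists I; split=> //; case: pI => _; apply.
- by move=> x [I [_ IM /IM]].
Qed.

(** When [I] is not inside [M], primality of [M] forces [J] inside [M], hence inside the core. *)
Lemma poisson_core_prime M : prime_ideal M -> poisson_prime (poisson_core M).
Proof.
move=> [idM M1 MM]; have [pC CM maxC] := poisson_coreP idM.
split=> //; first by move/CM.
move=> I J pI pJ IJ; have [IM|IM] := pselect (I `<=` M).
  by left; exact: maxC.
right; apply: maxC => // y Jy; apply: contrapT => My; apply: IM => x Ix.
by have /CM/MM[] := IJ _ _ Ix Jy.
Qed.

End PoissonIdealTheory.

(** * Torus actions *)

(** In characteristic zero the first [size p] naturals are distinct, too many to be all roots. *)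
Lemma poly_nat_nonroot (K : fieldType) (p : {poly K}) :
  [pchar K] =i pred0 -> p != 0 -> exists n : nat, p.[n%:R] != 0.
Proof.
move=> char0 p0; apply: contrapT => allroot.
have := max_poly_roots (rs := [seq n%:R | n <- iota 0 (size p)]) p0.
rewrite size_map size_iota ltnn.
have -> : all (root p) [seq n%:R | n <- iota 0 (size p)].
  apply/allP => _ /mapP[n _ ->]; apply: contrapT => /negP nr.
  by apply: allroot; exists n.
rewrite map_inj_uniq ?iota_uniq => [|m n mn]; first by move=> /(_ isT isT).
wlog le_mn : m n mn / (m <= n)%N.
  by move=> W; case/orP: (leq_total m n) => /W; [apply|move=> e; apply/esym/e].
have /pcharf0P/(_ (n - m)%N) := char0.
by rewrite natrB // mn subrr eqxx => /esym; rewrite subn_eq0 => nm; lia.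
Qed.

(** * Regular functions along a line through two points of the torus *)

Section LineRegular.
Variables (k K : fieldType) (iota : {rmorphism k -> K}) (r : nat).
Variables h0 h1 : torus k r.
Implicit Types (h : torus k r) (F : torus k r -> K).

Definition line_coord (i : 'I_r) : {poly k} :=
  (val (h0 i))%:P + (val (h1 i) - val (h0 i))%:P * 'X.

(** Its roots are the parameters at which the line leaves the torus. *)
Definition line_prod : {poly k} := \prod_i line_coord i.

Definition on_line h (t : k) := forall i, val (h i) = (line_coord i).[t].

(* Along the line through h0 and h1, F is a quotient of polynomials in the
   parameter whose denominator is a power of the product of the coordinates. *)
Definition line_regular F := exists N (G : {poly K}), forall t h, on_line h t ->
  G.[iota t] = iota line_prod.[t] ^+ N * F h.

Lemma on_line0 : on_line h0 0.
Proof. by move=> i; rewrite /line_coord !hornerE. Qed.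

Lemma on_line1 : on_line h1 1.
Proof.
move=> i; rewrite /line_coord !(hornerD, hornerM, hornerC, hornerX).
by rewrite mulr1 addrC subrK.
Qed.

Lemma line_prod_neq0 h t : on_line h t -> line_prod.[t] != 0.
Proof.
move=> ht; rewrite horner_prod; apply/prodf_neq0 => i _.
by rewrite -ht; exact: kstar_neq0.
Qed.

Lemma on_line_exists t : line_prod.[t] != 0 -> exists h, on_line h t.
Proof.
rewrite horner_prod => /prodf_neq0 t0.
by exists [ffun i => Kstar (t0 i isT)] => i; rewrite ffunE.
Qed.

Lemma line_regular_const c : line_regular (fun=> c).
Proof. by exists 0%N, c%:P => t h _; rewrite hornerC expr0 mul1r. Qed.

Lemma line_regularD F F' : line_regular F -> line_regular F' ->
  line_regular (fun h => F h + F' h).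
Proof.
move=> [N [G GE]] [N' [G' GE']].
exists (N + N')%N, (map_poly iota line_prod ^+ N' * G
  + map_poly iota line_prod ^+ N * G') => t h ht.
rewrite hornerD !hornerM !horner_exp !horner_map /= (GE _ _ ht) (GE' _ _ ht).
by rewrite exprD; ring.
Qed.

Lemma line_regularM F F' : line_regular F -> line_regular F' ->
  line_regular (fun h => F h * F' h).
Proof.
move=> [N [G GE]] [N' [G' GE']]; exists (N + N')%N, (G * G') => t h ht.
by rewrite hornerM (GE _ _ ht) (GE' _ _ ht) exprD; ring.
Qed.

Lemma line_regular_sum (T : Type) (s : seq T) (F : T -> torus k r -> K) :
  (forall x, line_regular (F x)) -> line_regular (fun h => \sum_(x <- s) F x h).
Proof.
move=> regF; elim: s => [|x s IH].
  rewrite (_ : (fun _ => _) = fun=> 0); first exact: line_regular_const.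
  by apply/funext => h; rewrite big_nil.
rewrite (_ : (fun _ => _) = fun h => F x h + \sum_(x <- s) F x h).
  exact: line_regularD.
by apply/funext => h; rewrite big_cons.
Qed.

Lemma line_regular_prod (T : Type) (s : seq T) (F : T -> torus k r -> K) :
  (forall x, line_regular (F x)) ->
  line_regular (fun h => \prod_(x <- s) F x h).
Proof.
move=> regF; elim: s => [|x s IH].
  rewrite (_ : (fun _ => _) = fun=> 1); first exact: line_regular_const.
  by apply/funext => h; rewrite big_nil.
rewrite (_ : (fun _ => _) = fun h => F x h * \prod_(x <- s) F x h).
  exact: line_regularM.
by apply/funext => h; rewrite big_cons.
Qed.

Lemma line_regular_coordX i (z : int) :
  line_regular (fun h => iota (val (h i) ^ z)).
Proof.
case: z => n.
  exists 0%N, (map_poly iota (line_coord i) ^+ n) => t h ht.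
  by rewrite expr0 mul1r horner_exp horner_map /= -ht rmorphXn.
(* The inverse of one coordinate is the product of the others divided by [line_prod]; the exponent
   here is -(n+1). *)
exists n.+1, (map_poly iota (\prod_(j | j != i) line_coord j) ^+ n.+1).
move=> t h ht.
rewrite horner_exp horner_map /= -!rmorphXn -rmorphM /line_prod.
congr (iota _); rewrite [in RHS](bigD1 i) //= hornerM -ht exprMn.
by rewrite mulrAC NegzE -exprnN mulfV ?mul1r // expf_neq0 //; exact: kstar_neq0.
Qed.

Lemma line_regular_regular (f : torus k r -> k) :
  regular_function f -> line_regular (fun h => iota (f h)).
Proof.
move=> [s fE].
rewrite (_ : (fun _ => _) = fun h => \sum_(m <- s)
    iota m.1 * \prod_i iota (val (h i) ^ m.2 i)).
  apply: line_regular_sum => m; apply: line_regularM.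
    exact: line_regular_const.
  by apply: line_regular_prod => i; exact: line_regular_coordX.
apply/funext => h; rewrite fE rmorph_sum; apply: eq_bigr => m _.
by rewrite rmorphM rmorph_prod.
Qed.

(* The restrictions to the line are nonzero rational functions of one
   parameter, hence have finitely many zeros. *)
Lemma line_regular_neq0 F F' : [pchar k] =i pred0 ->
  line_regular F -> line_regular F' -> F h0 != 0 -> F' h1 != 0 ->
  exists h, F h != 0 /\ F' h != 0.
Proof.
move=> char0 [N [G GE]] [N' [G' GE']] F0 F1.
have iota0 x : x != 0 -> iota x != 0 by rewrite fmorph_eq0.
have nz (p : {poly K}) t : p.[t] != 0 -> p != 0.
  by apply: contra_neq => ->; rewrite horner0.
have G0 : G != 0.
  apply: (nz _ (iota 0)); rewrite (GE _ _ on_line0) mulf_neq0 ?expf_neq0 //.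
  exact/iota0/line_prod_neq0/on_line0.
have G'0 : G' != 0.
  apply: (nz _ (iota 1)); rewrite (GE' _ _ on_line1) mulf_neq0 ?expf_neq0 //.
  exact/iota0/line_prod_neq0/on_line1.
have p0 : map_poly iota line_prod != 0.
  rewrite map_poly_eq0; apply: contraTneq (line_prod_neq0 on_line0) => ->.
  by rewrite horner0 eqxx.
(* The third factor ensures that the parameter [n] gives a point of the torus. *)
have [||n] := @poly_nat_nonroot K (G * G' * map_poly iota line_prod).
- by move=> p; rewrite (fmorph_pchar iota).
- by rewrite !mulf_neq0.
rewrite -(rmorph_nat iota) !hornerM horner_map !mulf_eq0 !negb_or fmorph_eq0.
move=> /andP[/andP[Gn G'n] /on_line_exists[h ht]].
exists h; split; apply/eqP => Fh.
  by rewrite (GE _ _ ht) Fh mulr0 eqxx in Gn.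
by rewrite (GE' _ _ ht) Fh mulr0 eqxx in G'n.
Qed.

End LineRegular.

(** * Eigenvectors and the ideals (Q : H) *)

Section TorusActionTheory.
Variables (k : fieldType) (R : poissonAlgType k) (r : nat).
Variable act : torus k r -> R -> R.
Hypothesis torus_act : poisson_torus_action act.
Implicit Types (h : torus k r) (x y : R) (Q : set R).

Let actL h (c : k) x y : act h (c *: x + y) = c *: act h x + act h y.
Proof. exact: tact_linear. Qed.

Lemma tact0 h : act h 0 = 0.
Proof. by have := actL h (-1) 0 0; rewrite scaler0 addr0 scaleN1r addNr. Qed.

Lemma tactD h x y : act h (x + y) = act h x + act h y.
Proof. by have := actL h 1 x y; rewrite !scale1r. Qed.

Lemma tactZ h (c : k) x : act h (c *: x) = c *: act h x.
Proof. by have := actL h c x 0; rewrite !tact0 !addr0. Qed.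

Lemma tactN h x : act h (- x) = - act h x.
Proof. by rewrite -scaleN1r tactZ scaleN1r. Qed.

Lemma tact_mul h x y : act h (x * y) = act h x * act h y.
Proof. by have [_] := tact_monoid_morphism torus_act h; exact. Qed.

Lemma tactK h x : act h^-1%g (act h x) = x.
Proof. by rewrite -(tactM torus_act) mulVg (tact1 torus_act). Qed.

Lemma tactVK h x : act h (act h^-1%g x) = x.
Proof. by rewrite -(tactM torus_act) mulgV (tact1 torus_act). Qed.

Lemma H_coreP Q x : H_core act Q x <-> forall h, Q (act h x).
Proof.
split=> [Qx h|Qx h _]; last first.
  by exists (act h^-1%g x); rewrite ?tactVK.
by have [y Qy <-] := Qx h^-1%g Logic.I; rewrite tactVK.
Qed.

Lemma H_core_sub Q : H_core act Q `<=` Q.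
Proof. by move=> x /H_coreP /(_ 1%g); rewrite (tact1 torus_act). Qed.

Lemma eigenvector_H_core Q v :
  is_ideal Q -> eigenvector act v -> Q v -> H_core act Q v.
Proof.
move=> idQ [_ eig] Qv; apply/H_coreP => h; have [c ->] := eig h.
by rewrite -mulr_algl; exact: idealM.
Qed.

Lemma H_core_H_ideal Q : is_ideal Q -> H_ideal act (H_core act Q).
Proof.
move=> idQ; split=> [|h].
  split.
  - by apply/H_coreP => h; rewrite tact0; exact: ideal0.
  - move=> x y /H_coreP Qx /H_coreP Qy; apply/H_coreP => h.
    by rewrite tactD; exact: idealD.
  - move=> a x /H_coreP Qx; apply/H_coreP => h.
    by rewrite tact_mul; exact: idealM.
apply/seteqP; split=> [_ [x /H_coreP Qx <-]|x /H_coreP Qx].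
  by apply/H_coreP => g; rewrite -(tactM torus_act).
exists (act h^-1%g x); last exact: tactVK.
by apply/H_coreP => g; rewrite -(tactM torus_act).
Qed.

Lemma H_core_poisson Q : poisson_ideal Q -> poisson_ideal (H_core act Q).
Proof.
move=> [idQ pQ]; split; first by case: (H_core_H_ideal idQ).
move=> a x /H_coreP Qx; apply/H_coreP => h.
by rewrite (tact_pbracket torus_act); exact: pQ.
Qed.

Hypothesis rational_act : rational_action act.

(** The scalars are nonzero because [act h] is invertible, so they define a map to [kstar k]. *)
Lemma eigenvector_eigenvalue v :
  eigenvector act v ->
  exists2 f, Defs.eigenspace act f v & rational_character f.
Proof.
move=> [v0 eig].
have star h : exists c : kstar k, act h v = val c *: v.
  have [c cE] := eig h; have [c0|c0] := eqVneq c 0; last by exists (Kstar c0).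
  case/eqP: v0; rewrite -(tactK h v) cE c0 scale0r; exact: tact0.
have [f fE] := choice star; exists f => //.
by have [_ _] := rational_act; apply; exists v.
Qed.

(** If h0(x) and h1(y) lie outside [Q], their classes are values of functions of h that are regular
    along the line through h0 and h1. A common point h where neither vanishes puts h(xy) outside
    [Q]. *)
Lemma H_core_prime Q : [pchar k] =i pred0 -> prime_ideal Q ->
  prime_ideal (H_core act Q).
Proof.
move=> char0 primeQ; have [idQ Q1 QM] := primeQ.
split; first by case: (H_core_H_ideal idQ).
  by move/H_core_sub.
move=> x y /H_coreP Qxy; apply: contrapT => /not_orP[].
move=> /H_coreP/existsNP[h0 Qx] /H_coreP/existsNP[h1 Qy].
pose phi : {rmorphism R -> fract primeQ} := to_fract primeQ.
have reg z :
    line_regular (scalar_to_fract primeQ) h0 h1 (fun h => phi (act h z)).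
  have [span _ _] := rational_act; have [s seig ->] := span z.
  elim: s seig => [|w s IH] seig.
    rewrite (_ : (fun _ => _) = fun=> 0); first exact: line_regular_const.
    by apply/funext => h; rewrite big_nil tact0 rmorph0.
  rewrite (_ : (fun _ => _) = fun h => phi (act h w)
      + phi (act h (\sum_(w <- s) w))); last first.
    by apply/funext => h; rewrite big_cons tactD rmorphD.
  apply: line_regularD; last first.
    by apply: IH => u us; apply: seig; rewrite inE us orbT.
  have [f fw [_ regf _]] := eigenvector_eigenvalue (seig w (mem_head _ _)).
  rewrite (_ : (fun _ => _) = fun h =>
      scalar_to_fract primeQ (val (f h)) * phi w).
    apply: line_regularM; last exact: line_regular_const.
    exact: (line_regular_regular (scalar_to_fract primeQ)).
  by apply/funext => h; rewrite fw; exact: to_fractZ.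
have [||h [hx hy]] := line_regular_neq0 char0 (reg x) (reg y) _ _.
- exact/to_fract_neq0.
- exact/to_fract_neq0.
have := Qxy h; rewrite tact_mul => /QM[].
  by move/to_fract_neq0: hx.
by move/to_fract_neq0: hy.
Qed.

End TorusActionTheory.

(** * The Dixmier-Moeglin equivalence *)

Section FractCenter.
Variables (k : fieldType) (R : poissonAlgType k) (P : set R).
Variables (primeP : prime_ideal P) (poisP : poisson_ideal P).
Local Notation phi := (to_fract primeP).

(** A derivation of the fraction field that vanishes on the image of [R] is zero. *)
Lemma fract_centerP z : (forall a, fract_pbracket (phi a) z = 0) ->
  poisson_center (fract_pbracket (primeP := primeP)) z.
Proof.
move=> z0 x; have [a [b [Pb xE]]] := fract_frac x.
have b0 : phi b != 0 by exact/to_fract_neq0.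
have z0' c : fract_pbracket z (phi c) = 0.
  by rewrite (fract_pbracketC poisP) z0 oppr0.
rewrite (fract_pbracketC poisP); apply/eqP; rewrite oppr_eq0.
have := fract_pbracket_leibniz poisP z x (phi b).
rewrite {1}xE (divfK b0) !z0' mulr0 addr0 => /esym/eqP.
by rewrite mulf_eq0 (negPf b0) orbF.
Qed.

Lemma horner_center z (q : {poly k}) :
  poisson_center (fract_pbracket (primeP := primeP)) z ->
  poisson_center (fract_pbracket (primeP := primeP))
    (map_poly (scalar_to_fract primeP) q).[z].
Proof.
move=> zc x; elim/poly_ind: q => [|q c IH].
  rewrite rmorph0 horner0.
  have := fract_pbracket_scalar (primeP := primeP) poisP 0 x.
  by rewrite rmorph0.
rewrite rmorphD rmorphM /= map_polyX map_polyC hornerD hornerMX hornerC.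
rewrite (fract_pbracketDr poisP) (fract_pbracket_leibniz poisP) IH zc.
by rewrite (fract_pbracket_scalar poisP) mul0r mulr0 !addr0.
Qed.

End FractCenter.

Section Homogenize.
Variables (k : fieldType) (R : poissonAlgType k).

(** The numerator of q(x/y). As an element of [R] it can be reduced modulo several primes, which
    compares the values of [q] at the ratio in their fraction fields. *)
Definition homogenize (q : {poly k}) (x y : R) : R :=
  \sum_(i < size q) q`_i *: (x ^+ i * y ^+ ((size q).-1 - i)).

Lemma to_fract_homogenize (P : set R) (primeP : prime_ideal P) q x y z :
  to_fract primeP x = z * to_fract primeP y ->
  to_fract primeP (homogenize q x y) = to_fract primeP y ^+ (size q).-1
    * (map_poly (scalar_to_fract primeP) q).[z].
Proof.
move=> xE; rewrite /homogenize rmorph_sum horner_coef size_map_poly mulr_sumr.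
apply: eq_bigr => i _; rewrite /= to_fractZ coef_map rmorphM !rmorphXn /= xE.
have -> : to_fract primeP y ^+ (size q).-1
    = to_fract primeP y ^+ i * to_fract primeP y ^+ ((size q).-1 - i).
  by rewrite -exprD subnKC // -ltnS (leq_trans (ltn_ord i)) // leqSpred.
by rewrite exprMn; ring.
Qed.

End Homogenize.

Section Equivalence.
Variables (k : fieldType) (R : poissonAlgType k).
Hypotheses (char0 : [pchar k] =i pred0) (affR : affine R).

Lemma pspec_inj (P Q : pspec R) : pspec_ideal P = pspec_ideal Q -> P = Q.
Proof.
case: P Q => [P pP] [Q pQ] /= PQ; case: _ / PQ pQ => pQ.
by rewrite (Prop_irrelevance pP pQ).
Qed.

Lemma pspec_prime (P : pspec R) : prime_ideal P.
Proof.
exact: (poisson_prime_prime char0 (affine_noetherian affR) (pspecP P)).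
Qed.

Lemma locally_closed_primitive (P : pspec R) :
  locally_closed_point P -> poisson_primitive P.
Proof.
move=> [U]; rewrite nbhsE => -[V [oV VP] VU] [C cC CU].
have [I _ VE] : zariski_closed (~` V) by apply/pspec_closedE/open_closedC.
have [I' _ CE] : zariski_closed C by exact/pspec_closedE.
have IP : ~ I `<=` P.
  by move=> IP; have VnP : (~` V) P by [rewrite VE]; apply: VnP.
(* Every point that does not contain [f] lies in [V]. *)
have /existsNP[f /not_implyP[If Pf]] := IP.
have [M [maxM PM Mf]] := prime_avoid_maximal affR (pspec_prime P) Pf.
exists M => //; have primeM := maximal_prime maxM.
have coreM := poisson_coreP (prime_idealP primeM).
pose Q := Pspec (poisson_core_prime primeM).
have [_ QM maxQ] := coreM.
have PQ : P `<=` Q by apply: maxQ => //; exact: poisson_primeP (pspecP P).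
suff -> : P = Q by [].
(* [Q] is in [C] because it contains [P], and in [U] because it avoids [f]. *)
suff : (C `&` U) Q by rewrite CU => ->.
split.
  have [] : (C `&` U) P by rewrite CU.
  by rewrite CE => I'P _; exact: subset_trans I'P PQ.
apply: VU; apply: contrapT => VQ.
have : (~` V) Q by [].
by rewrite VE => /(_ f If) /QM.
Qed.

Lemma primitive_center_algebraic (P : set R) (primeP : prime_ideal P) :
  poisson_primitive P ->
  forall z, poisson_center (fract_pbracket (primeP := primeP)) z ->
    algebraicOver (scalar_to_fract primeP) z.
Proof.
move=> [M maxM [poisP PM maxP]] z zc.
set phi : {rmorphism R -> fract primeP} := to_fract primeP.
have phi_bracket a b : phi (pbracket a b) = fract_pbracket (phi a) (phi b).
  by apply/esym; exact: fract_pbracketE.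
have primeM := maximal_prime maxM.
(* The denominators of [z]; centrality gives {a,r} z = {a, r z}. *)
pose I : set R := [set r | exists s, phi r * z = phi s].
have poisI : poisson_ideal I.
  split; first split.
  - by exists 0; rewrite rmorph0 mul0r.
  - by move=> x y [s xs] [t yt]; exists (s + t); rewrite !rmorphD mulrDl xs yt.
  - by move=> a x [s xs]; exists (a * s); rewrite !rmorphM -mulrA xs.
  - move=> a x [s xs]; exists (pbracket a s).
    rewrite !phi_bracket -xs.
    by rewrite (fract_pbracket_leibniz poisP) zc mulr0 addr0.
(* Otherwise [I] would be contained in the core [P], which misses the denominator of a fraction
   equal to [z]. *)
have [r [Ir Mr]] : exists r, I r /\ ~ M r.
  apply: contrapT => noI; have [a [b [Pb zE]]] := fract_frac z.
  apply: (Pb); apply: (maxP I) => // [r Ir|].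
    by apply: contrapT => Mr; apply: noI; exists r.
  exists a; rewrite zE mulrC divfK //; exact/to_fract_neq0.
have [s rs] := Ir.
pose psi := to_fract (maximal_prime maxM).
have psir : psi r != 0 by exact/to_fract_neq0.
have [q q0 qy] := maximal_residue_algebraic (maxM := maxM) (psi s / psi r) affR.
exists q => //; set w := (map_poly (scalar_to_fract primeP) q).[z].
(* The class of [u] is zero modulo [M], and is r^n q(z) modulo [P]. *)
pose u := homogenize q s r; pose n := (size q).-1.
have Mu : M u.
  apply/(to_fract_eq0 (maximal_prime maxM)).
  rewrite (to_fract_homogenize q (z := psi s / psi r)); last by rewrite divfK.
  by move: qy => /eqP ->; rewrite mulr0.
have uE : phi u = phi r ^+ n * w.
  by apply: to_fract_homogenize; rewrite -/phi -rs mulrC.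
have wc : poisson_center (fract_pbracket (primeP := primeP)) w.
  exact: horner_center.
pose I' : set R := [set y | exists t, phi y = w * phi t].
have poisI' : poisson_ideal I'.
  split; first split.
  - by exists 0; rewrite rmorph0 mulr0.
  - move=> x y [t xt] [t' yt]; exists (t + t').
    by rewrite !rmorphD mulrDr xt yt.
  - by move=> a x [t xt]; exists (a * t); rewrite !rmorphM xt mulrCA.
  - move=> a x [t xt]; exists (pbracket a t).
    rewrite !phi_bracket xt.
    by rewrite (fract_pbracket_leibniz poisP) wc mul0r add0r.
(* If y = w t, then r^n y = u t modulo [P], with [u] in [M] and [r] outside the prime [M]. *)
have I'M : I' `<=` M.
  move=> y [t yt]; have [idM M1 MM] := primeM.
  have : P (r ^+ n * y - u * t).
    apply/(to_fract_eq0 primeP); rewrite -/phi rmorphB !rmorphM rmorphXn uE yt.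
    by rewrite mulrA subrr.
  move=> /PM Mrut; have : M (r ^+ n * y).
    by rewrite -(subrK (u * t) (_ * y)); apply: idealD => //; exact: idealMr.
  elim: (n) => [|m IH]; first by rewrite expr0 mul1r.
  by rewrite exprS -mulrA => /MM[].
(* The numerator [c] belongs to [I'], hence to [P], so that w = 0. *)
have [c [d [Pd wE]]] := fract_frac w.
have : P c.
  apply: (maxP I') => //; exists d; rewrite wE divfK //; exact/to_fract_neq0.
move/(to_fract_eq0 primeP) => c0.
by rewrite /root -/w wE c0 mul0r eqxx.
Qed.

Variables (r : nat) (act : torus k r -> R -> R).
Hypotheses (torus_act : poisson_torus_action act).
Hypothesis (rational_act : rational_action act).

(** Both terms have the product of the three eigenvalues as eigenvalue. *)
Lemma eigenvector_bracket_term x0 a w :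
  eigenvector act x0 -> eigenvector act a -> eigenvector act w ->
  let v := x0 * pbracket a w - pbracket a x0 * w in
  v != 0 -> eigenvector act v.
Proof.
move=> [_ ex0] [_ ea] [_ ew] v v0; split=> [//|h].
have [[[c cE] [d dE]] [e eE]] := (ex0 h, ea h, ew h).
exists (c * d * e); rewrite /v.
have pZl (l : k) (x y : R) : pbracket (l *: x) y = l *: pbracket x y.
  by rewrite pbracketC pbracketZr -scalerN -pbracketC.
rewrite (tactD torus_act) (tactN torus_act) !(tact_mul torus_act).
rewrite !(tact_pbracket torus_act) cE dE eE !pbracketZr !pZl !scalerA.
rewrite -!scalerAl -!scalerAr !scalerA scalerBr.
by congr (_ *: _ - _ *: _); ring.
Qed.

(* Take x in Q outside P with the fewest eigenvector summands and let x0 be one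
   of them.  For every eigenvector a, x0{a,x} - {a,x0}x lies in Q and has fewer
   summands, hence lies in P; thus z = x/x0 is Poisson central.  An algebraic
   equation of z with nonzero constant term then puts a power of x0 in Q. *)
Lemma center_algebraic_sub (P Q : set R)
    (primeP : prime_ideal P) (primeQ : prime_ideal Q) :
  poisson_ideal P -> poisson_ideal Q ->
  (forall z, poisson_center (fract_pbracket (primeP := primeP)) z ->
    algebraicOver (scalar_to_fract primeP) z) ->
  P `<=` Q -> (forall v, eigenvector act v -> Q v -> P v) -> Q `<=` P.
Proof.
move=> poisP [_ poisQ] alg PQ eigQP; apply: contrapT => QP.
have [idP P1 PM] := primeP; have [idQ Q1 QM] := primeQ.
have [span _ _] := rational_act.
pose D n := `[< exists s, [/\ forall w, w \in s -> eigenvector act w,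
  Q (\sum_(w <- s) w), ~ P (\sum_(w <- s) w) & size s = n] >].
have exD : exists n, D n.
  have /existsNP[x /not_implyP[Qx Px]] := QP.
  have [s es xs] := span x.
  by exists (size s); apply/asboolP; exists s; rewrite -xs.
case: (ex_minnP exD) => n /asboolP[[|x0 s] [es Qs Ps ns]] nmin.
  by case: Ps; rewrite big_nil; exact: ideal0.
have minP t : (forall w, w \in t -> eigenvector act w) -> (size t < n)%N ->
    Q (\sum_(w <- t) w) -> P (\sum_(w <- t) w).
  move=> et tn Qt; apply: contrapT => Pt.
  by have := nmin (size t); rewrite leqNgt tn => /implyP;
    rewrite implybF => /asboolPn; apply; exists t.
have ex0 : eigenvector act x0 by apply: es; rewrite mem_head.
have es' w : w \in s -> eigenvector act w.
  by move=> ws; apply: es; rewrite inE ws orbT.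
set x := \sum_(w <- _) w in Qs Ps.
have xE : x = x0 + \sum_(w <- s) w by rewrite /x big_cons.
(* Otherwise the sum without [x0] would be a shorter counterexample. *)
have Px0 : ~ P x0.
  move=> Px0; apply: Ps; rewrite xE; apply: idealD => //; apply: minP => //.
    by rewrite -ns.
  have -> : \sum_(w <- s) w = x - x0 by rewrite xE addrC addKr.
  by apply: idealB => //; exact: PQ.
have brP a : P (x0 * pbracket a x - pbracket a x0 * x).
  have [t et ->] := span a; elim: t et => [|b t IH] et.
    rewrite big_nil (pbracketC 0 x) (pbracketC 0 x0) !pbracketr0.
    by rewrite !oppr0 mulr0 mul0r subr0; exact: ideal0.
  rewrite big_cons !pbracketDl.
  have -> : forall u v u' v' : R, x0 * (u + v) - (u' + v') * x
    = (x0 * u - u' * x) + (x0 * v - v' * x) by move=> *; ring.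
  apply: idealD => //; last first.
    by apply: IH => c ct; apply: et; rewrite inE ct orbT.
  have eb : eigenvector act b by apply: et; rewrite mem_head.
  pose g w := x0 * pbracket b w - pbracket b x0 * w.
  (* The summand [x0] contributes g(x0) = 0, so one term is lost; zero terms are filtered out
     because eigenvectors are nonzero. *)
  have gsum : x0 * pbracket b x - pbracket b x0 * x
      = \sum_(w <- [seq g w | w <- s & g w != 0]) w.
    rewrite big_map big_filter big_mkcond /=.
    transitivity (\sum_(w <- s) g w).
      rewrite xE pbracketDr; elim: (s) => [|w l IHl].
        by rewrite !big_nil pbracketr0; ring.
      rewrite !big_cons pbracketDr -IHl /g; ring.
    by apply: eq_bigr => w _; case: eqP.
  have Qg : Q (x0 * pbracket b x - pbracket b x0 * x).
    by apply: idealB => //; apply: idealM => //; exact: poisQ.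
  rewrite gsum; apply: minP; last by rewrite -gsum.
    move=> _ /mapP[w wl ->]; move: wl; rewrite mem_filter => /andP[gw ws].
    by apply: eigenvector_bracket_term => //; exact: es'.
  by rewrite size_map -ns ltnS size_filter count_size.
set phi : {rmorphism R -> fract primeP} := to_fract primeP.
have phi_bracket a b : phi (pbracket a b) = fract_pbracket (phi a) (phi b).
  by apply/esym; exact: fract_pbracketE.
have phix0 : phi x0 != 0 by exact/to_fract_neq0.
pose z := phi x / phi x0.
have zE : phi x = z * phi x0 by rewrite /z divfK.
have z0 : z != 0.
  by apply: (mulf_neq0 _ (invr_neq0 phix0)); exact/to_fract_neq0.
have /alg/(algebraic_coef0 z0)[q q0 qz] :
    poisson_center (fract_pbracket (primeP := primeP)) z.
  apply: fract_centerP => // a.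
  have := fract_pbracket_leibniz poisP (phi a) z (phi x0).
  rewrite -zE -!phi_bracket => e.
  have /(to_fract_eq0 primeP) := brP a.
  rewrite -/phi rmorphB !rmorphM e zE mulrDr mulrA => e'.
  by apply: (mulfI (mulf_neq0 phix0 phix0)); rewrite mulr0 -[RHS]e'; ring.
have Qx0 : ~ Q x0.
  by move=> Qx0; apply: Px0; exact: eigQP.
have /PQ /(to_fract_eq0 primeQ) : P (homogenize q x x0).
  apply/(to_fract_eq0 primeP); rewrite (to_fract_homogenize q zE).
  by move/eqP: qz => ->; rewrite mulr0.
(* As [x] lies in [Q], the ratio is 0 modulo [Q] and only the constant term of [q] survives, times a
   power of [x0]. *)
rewrite (to_fract_homogenize q (z := 0)); last first.
  by rewrite mul0r; apply/to_fract_eq0.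
move=> /eqP; rewrite mulf_eq0 expf_eq0 horner_coef0 coef_map fmorph_eq0.
rewrite (negPf q0) orbF => /andP[_ /eqP/to_fract_eq0].
exact: Qx0.
Qed.

Section Stratum.
Variables (J : set R) (P : pspec R).
Hypothesis stratP : H_stratum act J P.
Let primeP := pspec_prime P.

(** Eigenvectors in [Q] lie in (Q : H) = J = (P : H), hence in [P]. *)
Lemma center_algebraic_maximal :
  (forall z, poisson_center (fract_pbracket (primeP := primeP)) z ->
    algebraicOver (scalar_to_fract primeP) z) ->
  forall Q, H_stratum act J Q -> P `<=` Q -> Q = P.
Proof.
move=> alg Q stratQ PQ; apply/pspec_inj/seteqP; split=> //.
have primeQ := pspec_prime Q.
apply: (center_algebraic_sub primeQ _ _ alg) => // [| |v ev Qv].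
- exact: poisson_primeP (pspecP P).
- exact: poisson_primeP (pspecP Q).
apply: (H_core_sub torus_act); rewrite stratP -stratQ.
exact: eigenvector_H_core (prime_idealP primeQ) ev Qv.
Qed.

Lemma maximal_locally_closed :
  finite_set [set I | prime_poisson_H_ideal act I] ->
  (forall Q, H_stratum act J Q -> P `<=` Q -> Q = P) ->
  locally_closed_point P.
Proof.
move=> /finite_seqP[s sE] maxP.
have [idP P1 PM] := primeP.
(* [f] is a product of elements outside [P], one from each of the finitely many ideals not contained
   in [P]. *)
have [f Pf fs] : exists2 f, ~ pspec_ideal P f &
    forall I, prime_poisson_H_ideal act I -> ~ I `<=` P -> I f.
  have : forall I, I \in s -> is_ideal I.
    move=> I Is; have : [set` s] I by [].
    by rewrite -sE => -[[]].
  have : forall I, prime_poisson_H_ideal act I -> I \in s.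
    by move=> I pI; have : [set` s] I by rewrite -sE.
  move: (prime_poisson_H_ideal act) => T Ts ids.
  suff [f Pf fs] : exists2 f, ~ pspec_ideal P f &
      forall I, I \in s -> ~ I `<=` P -> I f.
    by exists f => // I TI; apply: fs; exact: Ts.
  elim: s ids {sE Ts} => [|I s IH] ids; first by exists 1.
  have [|f Pf fs] := IH; first by move=> K Ks; apply: ids; rewrite inE Ks orbT.
  have [g Pg gI] : exists2 g, ~ pspec_ideal P g & ~ I `<=` P -> I g.
    have [IP|IP] := pselect (I `<=` P); first by exists 1.
    by have /existsNP[g /not_implyP[Ig Pg]] := IP; exists g.
  exists (f * g); first by move=> /PM[].
  move=> K Ks KP; have idK := ids K Ks.
  move: Ks; rewrite inE => /orP[/eqP KI|/fs/(_ KP) Kf].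
    by apply: idealM => //; rewrite KI; apply: gI; rewrite -KI.
  exact: idealMr.
pose U : set (pspec R) := [set Q : pspec R | ~ pspec_ideal Q f].
exists U.
  apply: open_nbhs_nbhs; split; last exact: Pf.
  exists (ideal_span [:: f]); first exact: ideal_span_ideal.
  rewrite /U; apply/seteqP; split=> [Q /contrapT Qf|Q Qf QNf] /=.
    apply: ideal_span_sub => [|y]; first exact: prime_idealP (pspec_prime Q).
    by rewrite inE => /eqP ->.
  by apply: QNf; apply: Qf; apply: mem_ideal_span; rewrite mem_head.
exists [set Q : pspec R | P `<=` Q].
  by apply/pspec_closedE; exists P.
apply/seteqP; split=> [Q [/= PQ Qf]|Q ->]; last by split.
apply: maxP => //.
have idQ := prime_idealP (pspec_prime Q).
have HQ : prime_poisson_H_ideal act (H_core act Q).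
  split; first exact: H_core_prime (pspec_prime Q).
    by apply: (H_core_poisson torus_act); exact: poisson_primeP (pspecP Q).
  exact: H_core_H_ideal.
have QP : H_core act Q `<=` P.
  apply: contrapT => QP; apply: Qf; apply: (H_core_sub torus_act).
  exact: fs.
(* (Q : H) is H-stable and inside [P], hence inside (P : H); the converse follows from the inclusion
   of [P] in [Q]. *)
rewrite /H_stratum /= -stratP; apply/seteqP; split=> x.
  move=> /(H_coreP torus_act) Qx; apply/(H_coreP torus_act) => h; apply: QP.
  by apply/(H_coreP torus_act) => g; rewrite -(tactM torus_act).
move=> /(H_coreP torus_act) Px; apply/(H_coreP torus_act) => h.
exact/PQ/Px.
Qed.

End Stratum.
End Equivalence.

Theorem theorem4p3 (k : fieldType) (R : poissonAlgType k) (r : nat)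
    (act : torus k r -> R -> R) (J : set R) (P : pspec R) :
  [pchar k] =i pred0 ->
  affine R ->
  poisson_torus_action act ->
  rational_action act ->
  finite_set [set I | prime_poisson_H_ideal act I] ->
  prime_poisson_H_ideal act J ->
  H_stratum act J P ->
  exists primeP : prime_ideal P,
    [<-> locally_closed_point P;
         poisson_primitive P;
         forall z, poisson_center (fract_pbracket (primeP := primeP)) z ->
           algebraicOver (scalar_to_fract primeP) z;
         forall Q, H_stratum act J Q -> P `<=` Q -> Q = P].
Proof.
move=> char0 affR torus_act rational_act finH _ stratP.
exists (pspec_prime char0 affR P); tfae.
- exact: locally_closed_primitive.
- exact: primitive_center_algebraic.
- exact: center_algebraic_maximal.
- exact: maximal_locally_closed.
Qed.
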